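(* Let $K$ be a number field with ring of integers $\mathcal O_K$, and let $D\in K[X]$ be monic, not a square in $K[X]$, of even degree, and not Pellian over $K$. Let $\sqrt D=[a_0,a_1,a_2,\dots]$ be the continued fraction expansion of a square root $\sqrt D\in K((X^{-1}))$, with partial quotients $a_n\in K[X]$. Then for all but finitely many rational prime numbers $p$ there are infinitely many $n$ such that $p$ appears in the denominator of the leading coefficient $\mathrm{LC}(a_n)$, i.e. $\mathrm{LC}(a_n)$ cannot be written as $a/b$ with $a\in\mathcal O_K$ and $b\in\mathbb Z$ not divisible by $p$.
   Context: For a field $\mathbb K$ of characteristic $\neq 2$, $\mathbb K((X^{-1}))$ is the field of Laurent series $\sum_{n\le N}t_nX^n$ ($t_n\in\mathbb K$), with valuation $\operatorname{ord}$ given by $\operatorname{ord}(\sum_{n\le N}t_nX^n)=-N$ when $t_N\ne0$. For $\alpha\in\mathbb K((X^{-1}))$, $\lfloor\alpha\rfloor$ denotes the unique polynomial with $\operatorname{ord}(\alpha-\lfloor\alpha\rfloor)>0$. The continued fraction of $\alpha$ has complete quotients $\alpha_0=\alpha$, $\alpha_{n+1}=1/(\alpha_n-\lfloor\alpha_n\rfloor)$ (defined while $\alpha_n\notin\mathbb K[X]$) and partial quotients $a_n=\lfloor\alpha_n\rfloor$; we write $\alpha=[a_0,a_1,\dots]$. A monic polynomial of even degree has a square root in $K((X^{-1}))$. $D$ is called Pellian over $K$ if there exist $p,q\in K[X]$ with $q\neq0$ and $p^2-Dq^2\in K^*$ (equivalently $=1$). *)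

(* Defs.v *)
From HB Require Import structures.
From mathcomp Require Import all_boot all_order all_algebra all_field.
Set Implicit Arguments. Unset Strict Implicit. Unset Printing Implicit Defensive.
Import Order.TTheory GRing.Theory Num.Theory.
Local Open Scope ring_scope.

(* Laurent series in X^{-1} over K: an element is given by an upper bound
   lsN and a coefficient function; the series is sum_{n <= lsN} lsc n X^n,
   i.e. the coefficient of X^n is [ls_coef s n] (zero above the bound). *)
Record laurent (K : Type) := MkLaurent { lsN : int; lsc : int -> K }.

Section Laurent.
Variable K : nzRingType.

Definition ls_coef (s : laurent K) (n : int) : K :=
  if (n <= lsN s)%R then lsc s n else 0.

Definition ls_mulcoef (f g : laurent K) (n : int) : K :=
  \sum_(i < (absz (lsN f + lsN g - n)%R).+1)
     ls_coef f (lsN f - i%:Z) * ls_coef g (n - lsN f + i%:Z).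

Definition ls_mul_is (f g h : laurent K) : Prop :=
  forall n, ls_coef h n = ls_mulcoef f g n.

Definition ls_of_poly (p : {poly K}) : laurent K :=
  MkLaurent ((size p)%:Z - 1)
    (fun n => match n with Posz k => p`_k | Negz _ => 0 end).

Definition ls_floor (s : laurent K) : {poly K} :=
  \poly_(i < (absz (lsN s)%R).+1) ls_coef s i%:Z.

Definition ls_frac (s : laurent K) : laurent K := MkLaurent (-1) (ls_coef s).

Definition cf_complete (s : laurent K) (alpha : nat -> laurent K) : Prop :=
  (forall k, ls_coef (alpha 0%N) k = ls_coef s k) /\
  (forall n, ls_mul_is (alpha n.+1) (ls_frac (alpha n)) (ls_of_poly 1)).

End Laurent.

Definition pellian (K : fieldType) (D : {poly K}) : Prop :=
  exists p q : {poly K}, q != 0 /\ exists c : K, c != 0 /\ p ^+ 2 - D * q ^+ 2 = c%:P.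

Definition alg_integer (K : nzRingType) (x : K) : Prop :=
  exists P : {poly int}, P \is monic /\ root (map_poly (fun z : int => z%:~R) P) x.

(* Main.v *)
Require Import Defs.
From HB Require Import structures.
From mathcomp Require Import all_boot all_order all_algebra all_field.
From mathcomp Require Import ring zify ring_quotient generic_quotient.
From mathcomp Require Import boolp classical_sets.
Import Order.TTheory GRing.Theory Num.Theory.
Local Open Scope ring_scope.
Local Open Scope quotient_scope.

Set Implicit Arguments.
Unset Strict Implicit.
Unset Printing Implicit Defensive.

(** Let [V] be a valuation ring of [K] above [p], with finite residue field [k],
    and write [deg D = 2 d]. Scale the convergent [p_n / q_n] of [sqrt D] so
    that [q_n] becomes a polynomial over [V] with a unit coefficient; then [p_n]
    has coefficients in [V] too, and the reductions are good approximations of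
    the square root of the reduction of [D]. Their norms have degree less than
    [d], so by finiteness of [k] two of them differ by a unit of norm [1]: the
    reduction of [D] is Pellian, with solutions [(U, W)] of arbitrarily large
    degree [r = deg W].

    If [deg q_n <= r < deg q_(n+1)], comparing the two approximations gives
    [U q_n = W p_n] over [k], so [q_n] reduces to a multiple of [W] and
    [deg q_n = r]. Since [D] is not Pellian over [K], [deg q_(n+1) < r + d],
    whereas the reduction of [p_n - q_n sqrt D] has order [r + d]; hence its
    leading coefficient, a scalar over [LC(q_(n+1))], reduces to zero. By
    contrast the reduction of [p_(n-1) - q_(n-1) sqrt D] has order exactly [r].
    For the valuation [v] these facts say
    [v(LC q_n) + v(LC q_(n+1)) < 0 <= v(LC q_n) + v(LC q_(n-1))],
    so [LC(a_n) LC(a_(n+1)) = LC(q_(n+1)) / LC(q_(n-1))] is not in [V].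

    Laurent series are handled through the polynomial parts of [X^M f], for
    [M] large. *)

(** * Pell equations and approximations over a field *)

Local Notation psize p := (size p%R) (only parsing).

Section PellPolynomials.
Variable F : fieldType.
Implicit Types P Q D S U W N : {poly F}.

(* [size_mul] restated so that its sizes are syntactically those elaborated
   over [F], as [lia] requires. *)
Lemma size_polyM_neq0 P Q : P != 0 -> Q != 0 ->
  psize (P * Q) = (size P + size Q).-1.
Proof. exact: size_mul. Qed.

Lemma size_polyXnM P n : P != 0 -> psize ('X^n * P) = (n + size P)%N.
Proof. by move=> nz; rewrite size_monicM ?monicXn // size_polyXn. Qed.

Lemma coef_neq0_size P i : P`_i != 0 -> (i < size P)%N.
Proof. by rewrite ltnNge; apply: contra => /(nth_default 0)->. Qed.

Lemma size_polyM_bound P Q a b :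
  (size P <= a)%N -> (size Q <= b)%N -> (psize (P * Q) <= (a + b).-1)%N.
Proof. by move=> ha hb; have := size_polyMleq P Q; lia. Qed.

Lemma size_polyD_bound P Q a :
  (size P <= a)%N -> (size Q <= a)%N -> (psize (P + Q) <= a)%N.
Proof. by move=> ha hb; have := size_polyD P Q; lia. Qed.

Lemma size_polyXnM_bound P n a : (size P <= a)%N -> (psize ('X^n * P) <= n + a)%N.
Proof.
move=> ha; apply: leq_trans (size_polyM_bound (leqnn _) ha) _.
by rewrite size_polyXn.
Qed.

Lemma size_polyXnM_cancel P n a : (psize ('X^n * P) <= n + a)%N -> (size P <= a)%N.
Proof.
have [->|nz] := eqVneq P 0; first by rewrite size_poly0.
by rewrite size_polyXnM // leq_add2l.
Qed.

Lemma square_of_norm_eq0 D P Q : Q != 0 -> P ^+ 2 - D * Q ^+ 2 = 0 ->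
  exists R, D = R ^+ 2.
Proof.
move=> nzQ /eqP; rewrite subr_eq0 => /eqP e.
have: Q ^+ 2 %| P ^+ 2 by rewrite e dvdp_mull.
rewrite dvdp_pexp2r // => /dvdpP [R eR]; exists R.
apply: (mulIf (expf_neq0 2 nzQ)).
by rewrite -e eR exprMn.
Qed.

(** With [S] standing for [X^M sqrt D], the norm factors as [(P - Q sqrt D)(P + Q sqrt D)], of
    degrees at most [-b] and [d + a]. The truncation error of [S ^+ 2], bounded through [B], stays
    below [X^(M + M)] because [M] is large. *)
Lemma size_norm D S P Q M B d a b :
  (size S <= M + d + 1)%N -> (psize (S ^+ 2 - 'X^(M + M) * D) <= M + B)%N ->
  (size Q <= a + 1)%N -> (psize ('X^M * P - Q * S) + b <= M + 1)%N ->
  (B + a + a <= M)%N -> (psize (P ^+ 2 - D * Q ^+ 2) <= d + a + 1 - b)%N.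
Proof.
move=> hS hSD hQ hE hM; set E := 'X^M * P - Q * S in hE.
have e : 'X^(M + M) * (P ^+ 2 - D * Q ^+ 2) =
    E * (E + Q * S + Q * S) + Q * Q * (S ^+ 2 - 'X^(M + M) * D).
  by rewrite /E exprD; ring.
move: E hE e => E hE e.
apply: (@size_polyXnM_cancel _ (M + M)); rewrite e.
have hQS := size_polyM_bound hQ hS.
have hG : (psize (E + Q * S + Q * S) <= M + d + a + 1)%N.
  by rewrite !size_polyD_bound //; lia.
have h1 := size_polyM_bound (leqnn (size E)) hG.
have h2 := size_polyM_bound (size_polyM_bound hQ hQ) hSD.
have [E0|nzE] := eqVneq E 0.
  by rewrite E0 mul0r add0r; lia.
by apply: size_polyD_bound; rewrite -?size_poly_gt0 in nzE *; lia.
Qed.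

(** The constant [c] has lower degree than [D * W ^+ 2], so it affects neither the size nor the
    leading coefficient. *)
Lemma pell_size D U W (c : F) d : D \is monic -> size D = (2 * d + 1)%N ->
  (0 < d)%N -> W != 0 -> U ^+ 2 - D * W ^+ 2 = c%:P ->
  size U = (size W + d)%N /\ lead_coef U ^+ 2 = lead_coef W ^+ 2.
Proof.
move=> mD sD d0 nzW /eqP; rewrite subr_eq addrC => /eqP e.
have nzW2 : W ^+ 2 != 0 by rewrite expf_neq0.
have Wgt0 : (0 < size W)%N by rewrite size_poly_gt0.
have sW : psize (D * W ^+ 2) = (2 * d + (size W + size W).-1)%N.
  by rewrite size_polyM_neq0 ?(monic_neq0 mD) // sD expr2 size_polyM_neq0 //; lia.
have hc : (psize (c%:P) < psize (D * W ^+ 2))%N.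
  by rewrite (leq_ltn_trans (size_polyC_leq1 c)) // sW; lia.
have lU : lead_coef (U ^+ 2) = lead_coef (W ^+ 2).
  by rewrite e lead_coefDl // lead_coef_monicM.
split; last by rewrite -!lead_coef_exp.
have: psize (U ^+ 2) = psize (D * W ^+ 2) by rewrite e size_polyDl.
have nzU : U != 0.
  apply/negP => /eqP U0; move: lU; rewrite U0 expr2 mul0r lead_coef0 => /esym/eqP.
  by rewrite lead_coef_eq0; apply/negP.
by rewrite sW expr2 size_polyM_neq0 //; lia.
Qed.

(** The product of [U - W sqrt D] and [U + W sqrt D] is constant. The hypothesis on leading
    coefficients selects the sign for which, as 2 is nonzero, the second factor has full degree
    [r + d]; the first then has degree at most [-(r + d)]. *)
Lemma pell_remainder_size D S U W (c : F) M B d r : (2%:R : F) != 0 ->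
  size S = (M + d + 1)%N -> (psize (S ^+ 2 - 'X^(M + M) * D) <= M + B)%N ->
  size W = (r + 1)%N -> size U = (r + d + 1)%N ->
  lead_coef U = lead_coef W * lead_coef S ->
  U ^+ 2 - D * W ^+ 2 = c%:P -> (B + r + r <= M)%N ->
  (psize ('X^M * U - W * S) <= M + 1 - (r + d))%N.
Proof.
move=> two sS hSD sW sU lU e hM.
set R := _ - _; pose G := 'X^M * U + W * S.
have nzS : S != 0 by rewrite -size_poly_gt0 sS addn1.
have nzW : W != 0 by rewrite -size_poly_gt0 sW addn1.
have nzU : U != 0 by rewrite -size_poly_gt0 sU addn1.
have sG : size G = (M + r + d + 1)%N.
  apply/eqP; rewrite eqn_leq; apply/andP; split.
    apply: size_polyD_bound.
      by apply: leq_trans (size_polyXnM_bound _ (leqnn _)) _; lia.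
    by apply: leq_trans (size_polyM_bound (leqnn _) (leqnn _)) _; lia.
  rewrite addn1; apply: coef_neq0_size; rewrite coefD.
  have -> : (M + r + d)%N = (psize ('X^M * U)).-1.
    by rewrite size_polyXnM //; lia.
  rewrite -lead_coefE lead_coef_monicM ?monicXn //.
  have -> : (psize ('X^M * U)).-1 = (psize (W * S)).-1.
    by rewrite size_polyXnM // size_polyM_neq0 //; lia.
  rewrite -lead_coefE lead_coefM -lU -mulr2n -mulr_natl.
  by rewrite mulf_neq0 // lead_coef_eq0.
have eRG : R * G = 'X^(M + M) * c%:P - W * W * (S ^+ 2 - 'X^(M + M) * D).
  by rewrite -e /R /G exprD; ring.
have [->|nzR] := eqVneq R 0; first by rewrite size_poly0.
have: (psize (R * G) <= M + M + 1)%N.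
  rewrite eRG; apply: size_polyD_bound.
    exact: size_polyXnM_bound (size_polyC_leq1 c).
  rewrite size_polyN.
  apply: leq_trans (size_polyM_bound (size_polyM_bound (leqnn _) (leqnn _)) hSD) _.
  by lia.
have nzG : G != 0 by rewrite -size_poly_gt0 sG addn1.
by rewrite size_polyM_neq0 // sG; lia.
Qed.

(** The norm equation is a Bezout relation between [U] and [W]: multiplying it by [Q] exhibits
    [c *: Q] as a multiple of [W]. *)
Lemma pell_dvd D U W P Q (c : F) : c != 0 -> U ^+ 2 - D * W ^+ 2 = c%:P ->
  U * Q = W * P -> W %| Q.
Proof.
move=> nzc e eq.
have -> : Q = W * (c^-1 *: (U * P - D * W * Q)).
  apply: (scalerI nzc); rewrite -scalerAr scalerA divff // scale1r -mul_polyC -e.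
  have -> : (U ^+ 2 - D * W ^+ 2) * Q = U * (U * Q) - D * W ^+ 2 * Q by ring.
  by rewrite eq; ring.
exact: dvdp_mulr.
Qed.

(* Both approximations being good forces the determinant [U Q - W P] to
   have negative degree. *)
Lemma approx_cross_eq S U W P Q M r d a :
  (size W <= r + 1)%N -> (psize ('X^M * U - W * S) <= M + 1 - (r + d))%N ->
  (size Q <= a + 1)%N -> (a < r + d)%N -> (r + d <= M)%N ->
  (psize ('X^M * P - Q * S) + r <= M)%N ->
  U * Q = W * P.
Proof.
move=> sW sR sQ ha hM sE; apply/eqP; rewrite -subr_eq0 -size_poly_leq0.
apply: (@size_polyXnM_cancel _ M).
have -> : 'X^M * (U * Q - W * P) =
    ('X^M * U - W * S) * Q - ('X^M * P - Q * S) * W by ring.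
apply: size_polyD_bound; rewrite ?size_polyN.
  by apply: leq_trans (size_polyM_bound sR sQ) _; lia.
by apply: leq_trans (size_polyM_bound (leqnn _) sW) _; lia.
Qed.

(** The new solution is the square of [U + W sqrt D]. *)
Lemma pell_double D U W d : (2%:R : F) != 0 -> D \is monic ->
  size D = (2 * d + 1)%N -> (0 < d)%N -> W != 0 -> U ^+ 2 - D * W ^+ 2 = 1 ->
  exists U' W', (size W < size W')%N /\ U' ^+ 2 - D * W' ^+ 2 = 1.
Proof.
move=> two mD sD d0 nzW e.
have [sU _] : size U = (size W + d)%N /\ lead_coef U ^+ 2 = lead_coef W ^+ 2.
  exact: (pell_size (c := 1) mD sD d0 nzW).
exists (U ^+ 2 + D * W ^+ 2), (2%:R *: (U * W)); split.
  have Wgt0 : (0 < size W)%N by rewrite size_poly_gt0.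
  have nzU : U != 0 by rewrite -size_poly_gt0; lia.
  by rewrite size_scale // size_polyM_neq0 //; lia.
have -> : (U ^+ 2 + D * W ^+ 2) ^+ 2 - D * (2%:R *: (U * W)) ^+ 2 =
    (U ^+ 2 - D * W ^+ 2) ^+ 2.
  by rewrite -mul_polyC polyCMn; ring.
by rewrite e expr1n.
Qed.

Lemma pell_size_unbounded D U W d : (2%:R : F) != 0 -> D \is monic ->
  size D = (2 * d + 1)%N -> (0 < d)%N -> W != 0 -> U ^+ 2 - D * W ^+ 2 = 1 ->
  forall t, exists U' W', (t < size W')%N /\ U' ^+ 2 - D * W' ^+ 2 = 1.
Proof.
move=> two mD sD d0 nzW e; elim=> [|t [U' [W' [st e']]]].
  by exists U, W; rewrite size_poly_gt0.
have nzW' : W' != 0 by rewrite -size_poly_gt0; lia.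
have [U2 [W2 [s2 e2]]] := pell_double two mD sD d0 nzW' e'.
by exists U2, W2; split=> //; lia.
Qed.

(* Quotient of two elements [P + Q sqrt D] of equal norm that are congruent
   modulo their norm. *)
Lemma pell_of_congruent D P1 Q1 P2 Q2 N :
  N != 0 -> P1 ^+ 2 - D * Q1 ^+ 2 = N -> P2 ^+ 2 - D * Q2 ^+ 2 = N ->
  P1 %% N = P2 %% N -> Q1 %% N = Q2 %% N ->
  (exists U W, W != 0 /\ U ^+ 2 - D * W ^+ 2 = 1) \/
  (exists c : F, P1 = c *: P2 /\ Q1 = c *: Q2).
Proof.
move=> nzN e1 e2 eP eQ.
have dP : N %| P1 - P2 by rewrite /dvdp modpD modpN eP subrr.
have dQ : N %| Q1 - Q2 by rewrite /dvdp modpD modpN eQ subrr.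
have /dvdpP [U eU] : N %| P1 * P2 - D * Q1 * Q2.
  have -> : P1 * P2 - D * Q1 * Q2 =
      N + (P1 - P2) * P2 - D * Q2 * (Q1 - Q2) by rewrite -e2; ring.
  by apply: dvdp_sub; [apply: dvdp_add => //; apply: dvdp_mulr | apply: dvdp_mull].
have /dvdpP [W eW] : N %| Q1 * P2 - P1 * Q2.
  have -> : Q1 * P2 - P1 * Q2 = (Q1 - Q2) * P2 - (P1 - P2) * Q2 by ring.
  by apply: dvdp_sub; apply: dvdp_mulr.
have eUW : U ^+ 2 - D * W ^+ 2 = 1.
  apply: (mulIf (expf_neq0 2 nzN)); rewrite mul1r.
  have -> : (U ^+ 2 - D * W ^+ 2) * N ^+ 2 = (U * N) ^+ 2 - D * (W * N) ^+ 2 by ring.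
  have eN : N ^+ 2 = (P1 ^+ 2 - D * Q1 ^+ 2) * (P2 ^+ 2 - D * Q2 ^+ 2).
    by rewrite e1 e2 expr2.
  by rewrite -eU -eW eN; ring.
(* If [W] vanishes then [U ^+ 2 = 1], so [U] is a constant and the quotient of the two elements is a
   scalar. *)
have [W0|nzW] := eqVneq W 0; last by left; exists U, W.
right; rewrite W0 mul0r in eW.
have {}eW : Q1 * P2 = P1 * Q2 by apply/eqP; rewrite -subr_eq0 eW.
have U1 : U ^+ 2 = 1 by rewrite -eUW W0 [0 ^+ 2]expr0n mulr0 subr0.
have nzU : U != 0 by apply: contra_eq_neq U1 => ->; rewrite expr0n eq_sym oner_neq0.
have : (size U <= 1)%N.
  have := size_polyM_neq0 nzU nzU; rewrite -expr2 U1 size_poly1.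
  by lia.
move=> /size1_polyC eUc; exists U`_0; rewrite -!mul_polyC -eUc.
split; apply: (mulIf nzN).
  have -> : U * P2 * N = P2 * (U * N) by ring.
  have -> : P1 * N = P2 * P1 * P2 - D * Q2 * (P1 * Q2) by rewrite -e2; ring.
  by rewrite -eU -eW; ring.
have -> : U * Q2 * N = Q2 * (U * N) by ring.
have -> : Q1 * N = P2 * (Q1 * P2) - D * Q1 * Q2 ^+ 2 by rewrite -e2; ring.
by rewrite -eU eW; ring.
Qed.

End PellPolynomials.

(** * Laurent series and continued fractions *)

Section LaurentCoefficients.
Variable K : nzRingType.
Implicit Types f g h : laurent K.

Lemma ls_coef_gt f n : (lsN f < n)%R -> ls_coef f n = 0.
Proof. by rewrite /ls_coef ltNge => /negbTE->. Qed.

Lemma coef_ls_of_poly (p : {poly K}) (n : int) :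
  ls_coef (ls_of_poly p) n = if (0 <= n)%R then p`_(absz n) else 0.
Proof.
rewrite /ls_coef /=; case: n => n /=; last by case: ifP.
by case: ifP => // h; rewrite nth_default //; lia.
Qed.

Lemma coef_ls_floor f i : (ls_floor f)`_i = ls_coef f i%:Z.
Proof.
rewrite coef_poly; case: ltnP => // h.
by rewrite ls_coef_gt //; lia.
Qed.

Lemma sum_nat_narrow (m n : nat) (G : nat -> K) : (m <= n)%N ->
  (forall i, (m <= i)%N -> G i = 0) ->
  \sum_(0 <= i < n) G i = \sum_(0 <= i < m) G i.
Proof.
move=> le0 z; rewrite (@big_cat_nat _ _ _ m) //=.
rewrite [X in _ + X]big_nat_cond [X in _ + X]big1 ?addr0 // => i /andP[/andP[hi _] _].
exact: z.
Qed.

(** Recasts the product formula, whose range depends on the bounds of [f] and [g], as a coefficient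
    of a product of shifted polynomials. For [k] at least [M + B] the terms lost at either end
    vanish, one factor being beyond its bound. *)
Lemma ls_mul_coef f g h : ls_mul_is f g h ->
  exists B, forall M k, (B <= M)%N -> (M + B <= k)%N ->
  \sum_(i < k.+1) ls_coef f (i%:Z - M%:Z) * ls_coef g ((k - i)%N%:Z - M%:Z) =
  ls_coef h ((k - M)%N%:Z - M%:Z).
Proof.
move=> e; exists (absz (lsN f) + absz (lsN g))%N => M k hM hk.
rewrite e /ls_mulcoef.
pose n := (k%:Z - M%:Z - M%:Z)%R.
have -> : ((k - M)%N%:Z - M%:Z)%R = n by rewrite /n; lia.
have en : n = (k%:Z - M%:Z - M%:Z)%R by [].
(* Above the top degree of the product every term is zero, although the absolute value in
   [ls_mulcoef] still gives a nonempty range. *)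
have [lt_n|le_n] := ltP (lsN f + lsN g) n.
  transitivity (0 : K); [|symmetry]; apply: big1 => i _; last first.
    by rewrite [X in _ * X]ls_coef_gt ?mulr0 //; lia.
  have [h1|h1] := ltP (lsN f) (i%:Z - M%:Z); first by rewrite ls_coef_gt ?mul0r.
  by rewrite [X in _ * X]ls_coef_gt ?mulr0 //; have := ltn_ord i; lia.
(* [a] is the position of the top term of [f] after the shift by [M]. Both sums are brought to the
   range up to [a], where they differ by a reversal. *)
pose a := absz (lsN f + M%:Z).
have ea : a%:Z = lsN f + M%:Z by rewrite /a; lia.
pose G i := ls_coef f (i%:Z - M%:Z) * ls_coef g ((k - i)%N%:Z - M%:Z).
pose H i := ls_coef f (lsN f - i%:Z) * ls_coef g (n - lsN f + i%:Z).
rewrite -(big_mkord xpredT G) -(big_mkord xpredT H).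
rewrite (@sum_nat_narrow a.+1); first last.
- by move=> i hi; rewrite /G ls_coef_gt ?mul0r //; lia.
- by lia.
rewrite -(@sum_nat_narrow (absz (lsN f + lsN g - n)%R).+1 a.+1); first last.
- by move=> i hi; rewrite /H [X in _ * X]ls_coef_gt ?mulr0 //; lia.
- by lia.
rewrite big_nat_rev /= !big_mkord; apply: eq_bigr => i _; rewrite /G /H.
have hi := ltn_ord i.
by congr (ls_coef _ _ * ls_coef _ _); lia.
Qed.

End LaurentCoefficients.

(** * Polynomial truncations of Laurent series *)

Section Truncation.
Variable K : fieldType.
Implicit Types f g h : laurent K.

(* [ls_trunc M f] is the polynomial part of [X^M f]. *)
Definition ls_trunc (M : nat) f : {poly K} :=
  \poly_(i < absz (lsN f) + M + 1) ls_coef f (i%:Z - M%:Z).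

(** The floor retyped, so that its sizes are elaborated over the field [K]. *)
Definition pfloor f : {poly K} := ls_floor f.

Lemma coef_ls_trunc M f i : (ls_trunc M f)`_i = ls_coef f (i%:Z - M%:Z).
Proof.
have aux (z : int) : (`|z| + M + 1 <= i)%N -> (z < i%:Z - M%:Z)%R by lia.
by rewrite coef_poly; case: ltnP => // /aux h; rewrite ls_coef_gt.
Qed.

Lemma size_ls_trunc f : exists C, forall M, (size (ls_trunc M f) <= M + C)%N.
Proof.
exists (absz (lsN f) + 1)%N => M; apply: leq_trans (size_poly _ _) _.
by lia.
Qed.

Lemma ls_trunc_ext M f g : ls_coef f =1 ls_coef g -> ls_trunc M f = ls_trunc M g.
Proof. by move=> e; apply/polyP => i; rewrite !coef_ls_trunc. Qed.

Lemma ls_trunc_of_poly M (p : {poly K}) : ls_trunc M (ls_of_poly p) = 'X^M * p.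
Proof.
apply/polyP => i; rewrite coef_ls_trunc coef_ls_of_poly coefXnM.
case: ltnP => h; first by case: ifP => //; lia.
by rewrite subzn.
Qed.

Lemma ls_trunc_floor M f :
  ls_trunc M f = 'X^M * pfloor f + ls_trunc M (ls_frac f).
Proof.
apply/polyP => i; rewrite coefD !coef_ls_trunc coefXnM /ls_frac.
case: ltnP => h.
  by rewrite add0r [RHS]/ls_coef /=; case: ifP => //; lia.
by rewrite coef_ls_floor subzn // [X in _ + X]ls_coef_gt ?addr0.
Qed.

Lemma size_ls_trunc_frac M f : (size (ls_trunc M (ls_frac f)) <= M)%N.
Proof.
apply/leq_sizeP => j hj; rewrite coef_ls_trunc ls_coef_gt //=.
by lia.
Qed.

Lemma ls_trunc_mul f g h : ls_mul_is f g h ->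
  exists B, forall M, (B <= M)%N ->
    (psize (ls_trunc M f * ls_trunc M g - 'X^M * ls_trunc M h) <= M + B)%N.
Proof.
move=> /ls_mul_coef [B e]; exists B => M hM.
apply/leq_sizeP => k hk; rewrite coefB coefM coefXnM ifF; last by lia.
under eq_bigr => i _ do rewrite !coef_ls_trunc.
by rewrite coef_ls_trunc e // subrr.
Qed.

End Truncation.

(** * Convergents and their remainders *)

Section ContinuedFraction.
Variables (K : fieldType) (s : laurent K) (alpha : nat -> laurent K).
Hypothesis halpha : cf_complete s alpha.

Local Notation a n := (pfloor (alpha n)).

(* [convergents x y n] holds the terms of index [n] and [n+1] of the
   sequence starting with [x], [y] and satisfying the recurrence of the
   continuants; indices are shifted by one, so [cf_den n = q_(n-1)]. *)
Fixpoint convergents (x y : {poly K}) (n : nat) : {poly K} * {poly K} :=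
  if n is m.+1 then
    let: (u, v) := convergents x y m in (v, a m.+1 * v + u)
  else (x, y).

Definition cf_num n := (convergents 1 (a 0) n).1.
Definition cf_den n := (convergents 0 1 n).1.

Lemma cf_numSS n : cf_num n.+2 = a n.+1 * cf_num n.+1 + cf_num n.
Proof. by rewrite /cf_num /=; case: (convergents _ _ n). Qed.

Lemma cf_denSS n : cf_den n.+2 = a n.+1 * cf_den n.+1 + cf_den n.
Proof. by rewrite /cf_den /=; case: (convergents _ _ n). Qed.

(** This is [X^M (p_(n-1) - q_(n-1) s)] with [s] truncated; the conventional values [p_(-1) = 1] and
    [q_(-1) = 0] start the recurrence at ['X^M]. *)
Definition cf_rem M n := 'X^M * cf_num n - cf_den n * ls_trunc M s.

Lemma cf_remSS M n : cf_rem M n.+2 = a n.+1 * cf_rem M n.+1 + cf_rem M n.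
Proof. by rewrite /cf_rem cf_numSS cf_denSS; ring. Qed.

Lemma cf_rem0 M : cf_rem M 0 = 'X^M.
Proof. by rewrite /cf_rem /cf_num /cf_den /= mulr1 mul0r subr0. Qed.

Lemma cf_rem1 M : cf_rem M 1 = - ls_trunc M (ls_frac (alpha 0)).
Proof.
have [e _] := halpha.
rewrite /cf_rem /cf_num /cf_den /= mul1r -(ls_trunc_ext M e) ls_trunc_floor.
by ring.
Qed.

Lemma cf_trunc_mul n : exists B, forall M, (B <= M)%N ->
  (psize (ls_trunc M (alpha n.+1) * ls_trunc M (ls_frac (alpha n)) - 'X^M * 'X^M)
    <= M + B)%N.
Proof.
have [_ /(_ n) /ls_trunc_mul [B hB]] := halpha.
by exists B => M /hB; rewrite ls_trunc_of_poly mulr1.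
Qed.

Lemma size_cf_rem n : exists C, forall M, (size (cf_rem M n) <= M + C)%N.
Proof.
have [C hC] := size_ls_trunc s.
exists (size (cf_num n) + size (cf_den n) + C)%N => M.
rewrite /cf_rem; apply: size_polyD_bound.
  by apply: leq_trans (size_polyXnM_bound _ (leqnn _)) _; lia.
rewrite size_polyN.
by apply: leq_trans (size_polyM_bound (leqnn _) (hC M)) _; lia.
Qed.

(* Truncated form of [alpha_(n+1) = - theta_(n-1) / theta_n], where
   [theta_n = p_n - q_n s]. *)
Lemma cf_rem_ratio n : exists B, forall M, (B <= M)%N ->
  (psize (ls_trunc M (alpha n.+1) * cf_rem M n.+1 + 'X^M * cf_rem M n) <= M + B)%N.
Proof.
elim: n => [|n [B1 hB1]].
  have [B hB] := cf_trunc_mul 0; exists B => M /hB.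
  rewrite cf_rem0 cf_rem1 mulrN -[X in (size (polyseq X) <= _)%N -> _]opprK size_polyN.
  by rewrite opprB addrC.
have [B2 hB2] := cf_trunc_mul n.+1.
have [C hC] := size_cf_rem n.+1; have [C' hC'] := size_ls_trunc (alpha n.+2).
exists (B1 + B2 + C + C')%N => M hM.
have {}hB1 := hB1 M ltac:(lia); have {}hB2 := hB2 M ltac:(lia).
move: hB1 hB2; set R := _ + _; set R2 := _ - _ => hR hR2.
(* After multiplication by [X^M], the new error combines the inductive error [R] with the error [R2]
   of the relation between [alpha (n.+2)] and the fractional part of [alpha (n.+1)]. *)
apply: (@size_polyXnM_cancel _ _ M).
have -> : 'X^M * (ls_trunc M (alpha n.+2) * cf_rem M n.+2 + 'X^M * cf_rem M n.+1) =
    ls_trunc M (alpha n.+2) * R - R2 * cf_rem M n.+1.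
  by rewrite /R /R2 cf_remSS (ls_trunc_floor M (alpha n.+1)); ring.
apply: size_polyD_bound; rewrite ?size_polyN.
  by apply: leq_trans (size_polyM_bound (hC' M) hR) _; lia.
by apply: leq_trans (size_polyM_bound hR2 (hC M)) _; lia.
Qed.

(** A fractional part has negative degree, so its inverse has positive degree, which its floor
    inherits. *)
Lemma size_partial_quotient n : (1 < size (a n.+1))%N.
Proof.
have [B hB] := cf_trunc_mul n; have {hB} := hB B.+1 ltac:(lia).
set M := B.+1; set A := ls_trunc M (alpha n.+1); set Phi := ls_trunc M _ => h.
have sPhi : (size Phi <= M)%N := size_ls_trunc_frac _ _.
have sAPhi : psize (A * Phi) = (M + M + 1)%N.
  rewrite -[A * Phi](subrK ('X^M * 'X^M)) addrC size_polyDl -exprD size_polyXn.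
    by rewrite addn1.
  by rewrite exprD; apply: leq_ltn_trans h _; rewrite /M; lia.
have := size_polyM_bound (leqnn (size A)) (leqnn (size Phi)); rewrite sAPhi => h2.
have eA : A = 'X^M * a n.+1 + ls_trunc M (ls_frac (alpha n.+1)) by exact: ls_trunc_floor.
have sX : (psize ('X^M * a n.+1) <= M + size (a n.+1))%N by exact: size_polyXnM_bound.
have := size_ls_trunc_frac M (alpha n.+1) => sF.
have : (size A <= maxn (M + size (a n.+1)) M)%N.
  rewrite eA; apply: size_polyD_bound; first by apply: leq_trans sX _; lia.
  by apply: leq_trans sF _; lia.
by lia.
Qed.

Lemma size_lead_trunc_alpha M n :
  size (ls_trunc M (alpha n.+1)) = (M + size (a n.+1))%N /\
  lead_coef (ls_trunc M (alpha n.+1)) = lead_coef (a n.+1).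
Proof.
have sa := size_partial_quotient n; have sF := size_ls_trunc_frac M (alpha n.+1).
have nza : a n.+1 != 0 by rewrite -size_poly_gt0; lia.
have sX := size_polyXnM M nza.
have lt : (size (ls_trunc M (ls_frac (alpha n.+1))) < psize ('X^M * a n.+1))%N by lia.
rewrite ls_trunc_floor size_polyDl // lead_coefDl //.
by rewrite lead_coef_monicM ?monicXn.
Qed.

Lemma size_cf_den_lt n : (size (cf_den n) < size (cf_den n.+1))%N.
Proof.
elim: n => [|n IHn]; first by rewrite /cf_den /= size_poly0 size_poly1.
have sa := size_partial_quotient n.
have nza : a n.+1 != 0 by rewrite -size_poly_gt0; lia.
have nzq : cf_den n.+1 != 0 by rewrite -size_poly_gt0; lia.
have sM := size_polyM_neq0 nza nzq.
by rewrite cf_denSS size_polyDl; lia.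
Qed.

Lemma cf_den_neq0 n : cf_den n.+1 != 0.
Proof. by rewrite -size_poly_gt0; have := size_cf_den_lt n; lia. Qed.

Lemma size_lead_cf_denSS n :
  (size (cf_den n.+2)).+1 = (size (a n.+1) + size (cf_den n.+1))%N /\
  lead_coef (cf_den n.+2) = lead_coef (a n.+1) * lead_coef (cf_den n.+1).
Proof.
have sa := size_partial_quotient n; have lt := size_cf_den_lt n.
have nza : a n.+1 != 0 by rewrite -size_poly_gt0; lia.
have sM := size_polyM_neq0 nza (cf_den_neq0 n).
rewrite cf_denSS size_polyDl ?lead_coefDl ?lead_coefM; try by lia.
by split=> //; lia.
Qed.

(** Leading-term form of [theta_(n-1) ~ (-1)^n / q_n]. By [cf_rem_ratio], each step divides the
    leading term of the remainder by minus that of the partial quotient, which multiplies the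
    leading term of the denominator. *)
Lemma size_lead_cf_rem n : exists B, forall M, (B <= M)%N ->
  (size (cf_rem M n) + size (cf_den n.+1) = M + 2)%N /\
  lead_coef (cf_rem M n) * lead_coef (cf_den n.+1) = (-1) ^+ n.
Proof.
elim: n => [|n [B hB]].
  exists 0%N => M _; rewrite cf_rem0 /cf_den /= size_polyXn size_poly1.
  by rewrite lead_coefXn lead_coef1 mulr1; split=> //; lia.
have [B' hB'] := cf_rem_ratio n.
exists (B + B' + size (cf_den n.+1) + 1)%N => M hM.
have {hB} [sE lE] := hB M ltac:(lia).
have {hB'} hR := hB' M ltac:(lia).
have [sA lA] := size_lead_trunc_alpha M n.
have [sq lq] := size_lead_cf_denSS n.
have nzE : cf_rem M n != 0 by rewrite -size_poly_gt0; lia.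
have sXE := size_polyXnM M nzE.
have sa := size_partial_quotient n.
have nzA : ls_trunc M (alpha n.+1) != 0 by rewrite -size_poly_gt0; lia.
set A := ls_trunc M _ in hR sA lA nzA; set R := _ + _ in hR.
have eAE : A * cf_rem M n.+1 = - ('X^M * cf_rem M n) + R by rewrite /R; ring.
have lt : (size R < psize (- ('X^M * cf_rem M n)))%N by rewrite size_polyN sXE; lia.
have sAE : psize (A * cf_rem M n.+1) = (M + size (cf_rem M n))%N.
  by rewrite eAE size_polyDl // size_polyN sXE.
have nzE' : cf_rem M n.+1 != 0.
  by apply: contraTneq isT => z; move: sAE; rewrite z mulr0 size_poly0; lia.
have sM := size_polyM_neq0 nzA nzE'.
split; first by lia.
have : lead_coef (A * cf_rem M n.+1) = - lead_coef (cf_rem M n).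
  by rewrite eAE lead_coefDl // lead_coefN lead_coef_monicM ?monicXn.
rewrite lead_coefM lA lq exprS -lE mulN1r -mulNr => <-.
by ring.
Qed.

End ContinuedFraction.

(** * Valuation rings *)

Section MaximalSubring.
Variables (K : fieldType) (V : subringClosed K) (x : K).
Hypothesis xV : x \in V.
Hypothesis invxV : x^-1 \notin V.
Hypothesis maxV : forall W : {pred K}, subring_closed W -> {subset V <= W} ->
  x^-1 \notin W -> {subset W <= V}.

Let nzx : x != 0.
Proof. by apply: contra invxV => /eqP->; rewrite invr0 rpred0. Qed.

(** The ring [V[y]] is strictly larger than [V], so by maximality it contains [x^-1]. *)
Lemma maximal_adjoin y : y \notin V ->
  exists2 f : {poly K}, f \is a polyOver V & x * f.[y] = 1.
Proof.
move=> yV; apply: contrapT => nof.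
pose W : {pred K} :=
  [pred z | `[< exists2 f : {poly K}, f \is a polyOver V & z = f.[y] >]].
have subW : subring_closed W.
  split.
  - by apply/asboolP; exists 1; rewrite ?rpred1 // hornerC.
  - move=> _ _ /asboolP[f fV ->] /asboolP[g gV ->]; apply/asboolP.
    by exists (f - g); rewrite ?rpredB // hornerD hornerN.
  - move=> _ _ /asboolP[f fV ->] /asboolP[g gV ->]; apply/asboolP.
    by exists (f * g); rewrite ?rpredM // hornerM.
have sVW : {subset V <= W}.
  by move=> z zV; apply/asboolP; exists z%:P; rewrite ?polyOverC // hornerC.
have yW : y \in W by apply/asboolP; exists 'X; rewrite ?polyOverX // hornerX.
suff xW : x^-1 \notin W by rewrite (maxV subW sVW xW yW) in yV.
apply/negP => /asboolP[f fV e]; apply: nof; exists f => //.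
by rewrite -e divff // nzx.
Qed.

Lemma clear_denominators (f : {poly K}) w n : f \is a polyOver V -> w \in V ->
  w != 0 -> (size f <= n)%N -> w ^+ n * f.[w^-1] \in V.
Proof.
move=> fV wV nzw hn; rewrite (horner_coef_wide _ hn) mulr_sumr rpred_sum // => i _.
have -> : w ^+ n * (f`_i * w^-1 ^+ i) = f`_i * w ^+ (n - i).
  have -> : w ^+ n = w ^+ (n - i) * w ^+ i by rewrite -exprD subnK // ltnW.
  by rewrite mulrCA -mulrA -exprMn divff // expr1n mulr1.
by rewrite rpredM ?rpredX //; apply/polyOverP.
Qed.

(** Let [w = 1 - x * b]. If [w^-1] were not in [V], then [x^-1] would be a polynomial in [w^-1] over
    [V]. Multiplying by a power of [w], which is congruent to 1 modulo [x], would put [x^-1] in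
    [V]. *)
Lemma maximal_unit b : b \in V -> (1 - x * b)^-1 \in V.
Proof.
move=> bV; set w := 1 - x * b.
have wV : w \in V by rewrite rpredB ?rpred1 ?rpredM.
have nzw : w != 0.
  apply: contra invxV; rewrite subr_eq0 => /eqP e.
  by rewrite -[x^-1]mulr1 e mulKf // nzx.
have wn n : exists2 c, c \in V & w ^+ n = 1 + x * c.
  elim: n => [|n [c cV IHn]]; first by exists 0; rewrite ?rpred0 // mulr0 addr0.
  exists (c - b - x * b * c); first by rewrite !rpredB ?rpredM.
  by rewrite exprS IHn /w; ring.
apply: contraT => /maximal_adjoin [f fV e]; case/negP: invxV.
have [c cV ec] := wn (size f).
have := clear_denominators fV wV nzw (leqnn _).
have ef : f.[w^-1] = x^-1 by rewrite -[LHS](mulKf nzx) e mulr1.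
rewrite ef ec mulrDl mul1r mulrAC divff ?nzx // mul1r => h.
by rewrite -(addrK c x^-1) rpredB.
Qed.

(** As [1 - x * g.[0]] is a unit, the relation for [y^-1] writes 1 as a combination of negative
    powers of [y]. Multiplying the leading term of [f] by it lowers the degree, and no negative
    power arises since [size g <= size f]. *)
Lemma lower_degree y (f g : {poly K}) : y != 0 -> f \is a polyOver V ->
  g \is a polyOver V -> x * f.[y] = 1 -> x * g.[y^-1] = 1 ->
  (size g <= size f)%N ->
  exists f' : {poly K}, [/\ f' \is a polyOver V, x * f'.[y] = 1 & (size f' < size f)%N].
Proof.
move=> nzy fV gV ef eg le.
have cV (h : {poly K}) i : h \is a polyOver V -> h`_i \in V by move/polyOverP.
have nzf : f != 0.
  by apply: contra_eq_neq ef => ->; rewrite horner0 mulr0 eq_sym oner_neq0.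
have [n sf] : exists n, size f = n.+1.
  by exists (size f).-1; rewrite prednK // size_poly_gt0.
pose u := (1 - x * g`_0)^-1; have uV : u \in V := maximal_unit (cV g 0%N gV).
pose k (j : nat) := f`_n * x * u * g`_j.+1.
have kV j : k j \in V by rewrite !rpredM ?cV.
(* The first sum is [f] without its leading term; the second rewrites that term, the index
   [(n - i).-1] being the one that contributes to [y ^+ i]. *)
exists (\poly_(i < n) f`_i + \poly_(i < n) k (n - i).-1); split.
- by rewrite rpredD //; apply/polyOver_poly => i _; rewrite ?cV.
- rewrite -{}ef; congr (_ * _); rewrite hornerD !horner_poly horner_coef sf.
  rewrite big_ord_recr /=; congr (_ + _).
  have e1 : u * x * (\sum_(j < n) g`_j.+1 * y^-1 ^+ j.+1) = 1.
    rewrite sf in le.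
    move: eg; rewrite (horner_coef_wide _ le) big_ord_recl expr0 mulr1 => eg.
    have nz : 1 - x * g`_0 != 0.
      apply: contra invxV; rewrite subr_eq0 => /eqP e.
      by rewrite -[x^-1]mulr1 e mulKf ?nzx // cV.
    rewrite -mulrA -[X in u * X](addKr (x * g`_0)) -mulrDr eg addrC mulrC.
    exact: divff.
  rewrite -[RHS]mulr1 -e1 !mulr_sumr [RHS](reindex_inj rev_ord_inj) /=.
  apply: eq_bigr => i _; rewrite /k.
  have hi := ltn_ord i.
  have -> : y ^+ n = y ^+ i * y ^+ (n - i.+1).+1 by rewrite -exprD; congr (_ ^+ _); lia.
  have -> : (n - i).-1 = (n - i.+1)%N by lia.
  rewrite exprVn; set t := y ^+ _.+1; have nzt : t != 0 by rewrite expf_neq0.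
  by field.
- by rewrite sf ltnS; apply: leq_trans (size_polyD _ _) _; rewrite geq_max !size_poly.
Qed.

(** If neither were in [V], both [y] and [y^-1] would satisfy relations as in [maximal_adjoin], and
    [lower_degree] would shorten the longer one indefinitely. *)
Lemma maximal_valuation y : (y \in V) || (y^-1 \in V).
Proof.
apply: contraT; rewrite negb_or => /andP[yV iyV].
have nzy : y != 0 by apply: contra yV => /eqP->; rewrite rpred0.
have [f fV ef] := maximal_adjoin yV; have [g gV eg] := maximal_adjoin iyV.
have [n] := ubnP (size f + size g); elim: n y f g nzy fV gV ef eg {yV iyV} => // n IHn.
move=> y f g nzy fV gV ef eg; rewrite ltnS => le.
have [gf|fg] := leqP (size g) (size f).
  have [f' [f'V ef' lt]] := lower_degree nzy fV gV ef eg gf.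
  by apply: (IHn y f' g) => //; apply: leq_trans le; rewrite ltn_add2r.
have ey : y = y^-1^-1 by rewrite invrK.
rewrite ey in ef.
have [g' [g'V eg' lt]] := lower_degree (invr_neq0 nzy) gV fV eg ef (ltnW fg).
apply: (IHn y f g') => //; first by rewrite -[y]invrK.
by apply: leq_trans le; rewrite ltn_add2l.
Qed.

End MaximalSubring.

(** Zorn's lemma gives a subring containing [V0] and maximal among those without [x^-1]. *)
Lemma exists_valuation_ring (K : fieldType) (V0 : {pred K}) (x : K) :
  subring_closed V0 -> x \in V0 -> x^-1 \notin V0 ->
  exists V : subringClosed K, [/\ {subset V0 <= V}, x^-1 \notin V &
    forall y, (y \in V) || (y^-1 \in V)].
Proof.
move=> sub0 x0 ix0.
pose ring (A : set K) := [/\ A 1, forall a b, A a -> A b -> A (a - b),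
  forall a b, A a -> A b -> A (a * b), forall a, a \in V0 -> A a & ~ A x^-1].
pose P (A : set K) := A = set0 \/ ring A.
have [A [PA maxA]] : exists A, P A /\ forall B, (A `<` B)%classic -> ~ P B.
  apply: Zorn_bigcup => F FP Ftot.
  have ringF X a : F X -> X a -> ring X by move=> /FP [-> []|].
  have [[X0 [FX0 [a0 X0a0]]]|noX] := pselect (exists X, F X /\ exists a, X a); last first.
    left; apply/seteqP; split=> // a [X FX Xa].
    by apply: noX; exists X; split=> //; exists a.
  right; have [X01 _ _ X0V _] := ringF _ _ FX0 X0a0.
  have join a b : (\bigcup_(X in F) X)%classic a -> (\bigcup_(X in F) X)%classic b ->
      exists X, [/\ F X, X a, X b & ring X].
    move=> [X FX Xa] [Y FY Yb].
    have [sXY|sYX] := Ftot _ _ FX FY; [exists Y | exists X]; split=> //.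
    - exact: sXY.
    - exact: ringF FY Yb.
    - exact: sYX.
    - exact: ringF FX Xa.
  split.
  - by exists X0.
  - move=> a b ha hb; have [X [FX Xa Xb [_ hB _ _ _]]] := join a b ha hb.
    by exists X => //; apply: hB.
  - move=> a b ha hb; have [X [FX Xa Xb [_ _ hM _ _]]] := join a b ha hb.
    by exists X => //; apply: hM.
  - by move=> a aV; exists X0 => //; apply: X0V.
  - by move=> [X FX Xx]; have [_ _ _ _ nx] := ringF _ _ FX Xx; apply: nx.
pose V : {pred K} := [pred y | `[< A y >]].
have ring0 : ring [set` V0]%classic.
  have [h1 hB hM] := sub0.
  by split=> //=; exact/negP.
have ringA : ring A.
  case: PA => // A0; exfalso; apply: (maxA [set` V0]%classic); last by right.
  rewrite A0; split=> // h; have [h1 _ _ _ _] := ring0.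
  exact: h h1.
have [A1 AB AM AV Ax] := ringA.
have subV : subring_closed V.
  split; first exact/asboolP.
  - by move=> a b /asboolP ha /asboolP hb; apply/asboolP/AB.
  - by move=> a b /asboolP ha /asboolP hb; apply/asboolP/AM.
have sV0 : {subset V0 <= V} by move=> a /AV ha; apply/asboolP.
have iV : x^-1 \notin V by apply/negP => /asboolP.
pose VR : subringClosed K := HB.pack V (GRing.isSubringClosed.Build K V subV).
exists VR; split=> //; apply: (@maximal_valuation K VR x (sV0 _ x0) iV).
move=> W [W1 WB WM] sVW xW y yW; apply: contraT => /asboolP nAy; exfalso.
apply: (maxA [set` W]%classic).
  split=> [a Aa|h]; first by apply: sVW; apply/asboolP.
  by apply: nAy; apply: h.
right; split=> //=; last exact/negP.
by move=> a /sV0 /sVW.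
Qed.

(** The reduction is a total function on [K], so that it applies to coefficients without subtypes;
    its values outside [V] are unconstrained. *)
Record residue_map (K k : fieldType) (V : subringClosed K) (phi : K -> k) : Prop :=
  ResidueMap {
    residue_map1 : phi 1 = 1;
    residue_mapD : {in V &, {morph phi : y z / y + z}};
    residue_mapM : {in V &, {morph phi : y z / y * z}};
    residue_map_eq0 :
      {in V, forall y, (phi y == 0) = (y == 0) || (y^-1 \notin V)};
    residue_map_surj : forall c, exists2 y, y \in V & phi y = c
  }.

(** * The residue field of a valuation ring *)

Section ResidueField.
Variables (K : fieldType) (V : subringClosed K).
Hypothesis valuationV : forall y, (y \in V) || (y^-1 \in V).

Definition val_ring := {y : K | y \in V}.
HB.instance Definition _ := SubChoice.on val_ring.
HB.instance Definition _ := [SubChoice_isSubComNzRing of val_ring by <:].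

(** The nonunits of [V]. Zero needs its own clause because [0^-1 = 0] lies in [V]. *)
Definition max_ideal : {pred val_ring} :=
  fun r => (val r == 0) || ((val r)^-1 \notin V).

Lemma max_ideal_closed : idealr_closed max_ideal.
Proof.
have mulP (a b : K) : a \in V -> (b == 0) || (b^-1 \notin V) ->
    (a * b == 0) || ((a * b)^-1 \notin V).
  move=> aV; have [->|nzb] := eqVneq b 0; first by rewrite mulr0 eqxx.
  have [->|nza] := eqVneq a 0; first by rewrite mul0r eqxx.
  move=> /= ibV; apply/orP; right; apply: contra ibV => h.
  have -> : b^-1 = a * (a * b)^-1 by rewrite invfM mulVKf.
  by rewrite rpredM.
split.
- by rewrite unfold_in /= eqxx.
- by rewrite unfold_in /= oner_eq0 invr1 rpred1.
move=> a u v hu hv; rewrite unfold_in; set w := val (a * u + v).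
have ew : w = val a * val u + val v by [].
have hau := mulP _ _ (valP a) hu.
have [w0|nzw] := eqVneq w 0; first by [].
apply/negP => iwV; set b := val a * val u in ew hau.
have bV : b \in V by rewrite rpredM ?(valP a) ?(valP u).
have [b0|nzb] := eqVneq b 0.
  move: hv iwV; rewrite unfold_in ew b0 add0r => /orP[/eqP z|/negP //].
  by move: nzw; rewrite ew b0 add0r z eqxx.
have [v0|nzv] := eqVneq (val v) 0.
  by move: hau iwV; rewrite ew v0 addr0 (negbTE nzb) => /negP.
rewrite (negbTE nzb) /= in hau; move: hv; rewrite unfold_in (negbTE nzv) /= => hv.
(* One of the two summands divides the other in [V]; were their sum a unit, the divisor would be one
   too. *)
have [/= h|/= h] := orP (valuationV (b / val v)).
  case/negP: hv; have -> : (val v)^-1 = w^-1 * (b / val v + 1).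
    by rewrite ew; field; rewrite nzv -ew.
  by rewrite rpredM // rpredD // rpred1.
case/negP: hau; have -> : b^-1 = w^-1 * ((b / val v)^-1 + 1).
  by rewrite ew; field; rewrite nzv nzb -ew.
by rewrite rpredM // rpredD // rpred1.
Qed.

HB.instance Definition _ := isIdealr.Build val_ring max_ideal max_ideal_closed.

Definition residue := {ideal_quot max_ideal}.
HB.instance Definition _ := GRing.ComNzRing.on residue.

Definition residue_of (y : K) : residue := \pi_residue (insubd (0 : val_ring) y).

Lemma residue_of_val r : residue_of (val r) = \pi_residue r.
Proof. by rewrite /residue_of valKd. Qed.

Lemma residue_ofE y (yV : y \in V) : residue_of y = \pi_residue (Sub y yV : val_ring).
Proof. by rewrite -residue_of_val. Qed.

Lemma residue_ofD y z : y \in V -> z \in V ->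
  residue_of (y + z) = residue_of y + residue_of z.
Proof.
move=> yV zV; have yzV : y + z \in V by rewrite rpredD.
rewrite !residue_ofE -rmorphD; congr (\pi_residue _); exact: val_inj.
Qed.

Lemma residue_ofM y z : y \in V -> z \in V ->
  residue_of (y * z) = residue_of y * residue_of z.
Proof.
move=> yV zV; have yzV : y * z \in V by rewrite rpredM.
rewrite !residue_ofE -rmorphM; congr (\pi_residue _); exact: val_inj.
Qed.

Lemma residue_of1 : residue_of 1 = 1.
Proof.
rewrite (residue_ofE (rpred1 V)) -(rmorph1 (\pi_residue)).
by congr (\pi_residue _); exact: val_inj.
Qed.

Lemma residue_of_eq0 y : y \in V -> (residue_of y == 0) = (y == 0) || (y^-1 \notin V).
Proof.
move=> yV; rewrite residue_ofE -(rmorph0 (\pi_residue)) -Quotient.idealrBE subr0.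
by rewrite unfold_in.
Qed.

Definition residue_inv (q : residue) : residue :=
  if q == 0 then 0 else residue_of (val (repr q))^-1.

Lemma residue_mulVf q : q != 0 -> residue_inv q * q = 1.
Proof.
rewrite /residue_inv => nz; rewrite (negbTE nz).
have eq : residue_of (val (repr q)) = q by rewrite residue_of_val reprK.
have rV : val (repr q) \in V := valP (repr q).
have : residue_of (val (repr q)) != 0 by rewrite eq.
rewrite residue_of_eq0 // negb_or negbK => /andP[nzr iV].
by rewrite -{2}eq -residue_ofM // mulVf // residue_of1.
Qed.

Lemma residue_inv0 : residue_inv 0 = 0.
Proof. by rewrite /residue_inv eqxx. Qed.

HB.instance Definition _ :=
  GRing.ComNzRing_isField.Build residue residue_mulVf residue_inv0.

Lemma exists_residue_field :
  exists (k : fieldType) (phi : K -> k), residue_map V phi.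
Proof.
exists (residue : fieldType), residue_of; split.
- exact: residue_of1.
- exact: residue_ofD.
- exact: residue_ofM.
- exact: residue_of_eq0.
- by move=> c; exists (val (repr c)); [exact: valP | rewrite residue_of_val reprK].
Qed.

End ResidueField.

Lemma infinite_pigeonhole (T : finType) (f : nat -> T) :
  exists t, forall m, exists2 n, (m <= n)%N & f n = t.
Proof.
apply: contrapT => /forallNP no.
have ub t : exists m, forall n, (m <= n)%N -> f n <> t.
  have /existsNP [m hm] := no t; exists m => n mn e; apply: hm.
  by exists n.
have [b hb] := fin_all_exists ub.
exact: (hb (f (\max_t b t)%N) (\max_t b t)%N (leq_bigmax _) erefl).
Qed.

(** * Coefficientwise reduction of polynomials *)

Section ResidueMap.
Variables (K k : fieldType) (V : subringClosed K) (phi : K -> k).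
Hypothesis hphi : residue_map V phi.

Let phi1 := residue_map1 hphi.
Let phiD := residue_mapD hphi.
Let phiM := residue_mapM hphi.

Lemma residue_map0 : phi 0 = 0.
Proof.
have := phiD (rpred0 V) (rpred0 V); rewrite addr0 => /eqP.
by rewrite eq_sym addrC -subr_eq0 addrK => /eqP.
Qed.

Lemma residue_mapN : {in V, {morph phi : y / - y}}.
Proof.
move=> y yV; apply/eqP; rewrite -subr_eq0 opprK -phiD ?rpredN //.
by rewrite addrC subrr residue_map0.
Qed.

Lemma residue_map_int (z : int) : phi z%:~R = z%:~R.
Proof.
have nat n : phi n%:R = n%:R.
  elim: n => [|n IHn]; first exact: residue_map0.
  by rewrite -addn1 !natrD phiD ?rpred_nat ?IHn ?phi1.
by case: z => n; rewrite ?NegzE ?rmorphN /= ?residue_mapN ?rpred_nat -?pmulrn ?nat.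
Qed.

Lemma residue_map_sum (I : finType) (G : I -> K) : (forall i, G i \in V) ->
  phi (\sum_i G i) = \sum_i phi (G i).
Proof.
(* Membership of the partial sums in [V] is carried along, since [phi] is additive only there. *)
move=> GV; apply: (@proj1 _ (\sum_i G i \in V)).
apply: (big_ind2 (fun u v => phi u = v /\ u \in V)).
- by rewrite residue_map0 rpred0.
- by move=> u u' v v' [<- uV] [<- vV]; rewrite phiD ?rpredD.
- by move=> i _; rewrite GV.
Qed.

Lemma residue_mapX y n : y \in V -> phi (y ^+ n) = phi y ^+ n.
Proof.
move=> yV; elim: n => [|n IHn]; first by rewrite !expr0 phi1.
by rewrite !exprS phiM ?rpredX // IHn.
Qed.

Lemma residue_map_unit y : y \in V -> y^-1 \in V -> y != 0 -> phi y != 0.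
Proof. by move=> yV iV nz; rewrite (residue_map_eq0 hphi) // negb_or negbK nz. Qed.

Lemma residue_map_inv y : y \in V -> phi y != 0 -> y != 0 /\ y^-1 \in V.
Proof. by move=> yV; rewrite (residue_map_eq0 hphi) // negb_or negbK => /andP[]. Qed.

Definition reduce (f : {poly K}) : {poly k} := \poly_(i < size f) phi f`_i.

Lemma coef_reduce f i : (reduce f)`_i = phi f`_i.
Proof.
by rewrite coef_poly; case: ltnP => // h; rewrite nth_default // residue_map0.
Qed.

Lemma size_reduce f : (size (reduce f) <= size f)%N.
Proof. exact: size_poly. Qed.

Lemma reduceD : {in polyOver V &, {morph reduce : f g / f + g}}.
Proof.
move=> f g /polyOverP fV /polyOverP gV; apply/polyP => i.
by rewrite coefD !coef_reduce coefD phiD.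
Qed.

Lemma reduceN : {in polyOver V, {morph reduce : f / - f}}.
Proof.
move=> f /polyOverP fV; apply/polyP => i.
by rewrite coefN !coef_reduce coefN residue_mapN.
Qed.

Lemma reduceM : {in polyOver V &, {morph reduce : f g / f * g}}.
Proof.
move=> f g /polyOverP fV /polyOverP gV; apply/polyP => i.
rewrite coefM coef_reduce coefM residue_map_sum; last by move=> j; rewrite rpredM.
by apply: eq_bigr => j _; rewrite !coef_reduce phiM.
Qed.

Lemma reduceXn n : reduce 'X^n = 'X^n.
Proof.
by apply/polyP => i; rewrite coef_reduce !coefXn; case: eqP; rewrite ?phi1 ?residue_map0.
Qed.

Lemma size_reduce_unit f : f \is a polyOver V -> phi (lead_coef f) != 0 ->
  size (reduce f) = size f /\ lead_coef (reduce f) = phi (lead_coef f).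
Proof.
move=> fV nz.
have s : size (reduce f) = size f.
  apply/eqP; rewrite eqn_leq size_reduce /=.
  have := @coef_neq0_size _ (reduce f) (size f).-1; rewrite coef_reduce -lead_coefE.
  by move=> /(_ nz); apply: leq_trans; exact: leqSpred.
by split; rewrite // lead_coefE s coef_reduce.
Qed.

End ResidueMap.

(** * Scaling polynomials and integral equations *)

Section NormalisingPolynomials.
Variables (K : fieldType) (V : subringClosed K).
Hypothesis valuationV : forall y, (y \in V) || (y^-1 \in V).

(** Divisibility in a valuation ring is total, so [c] can be taken of least valuation. *)
Lemma exists_dominating_term (s : seq K) : has (predC1 0) s ->
  exists c, [/\ c \in s, c != 0 & {in s, forall y, y / c \in V}].
Proof.
elim: s => // y s IHs /=.
have [/IHs [c [cs nzc hc]]|/hasPn zs] := boolP (has (predC1 0) s); last first.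
  rewrite orbF => nzy; exists y; split=> //; first exact: mem_head.
  move=> z; rewrite inE => /orP[/eqP->|/zs]; first by rewrite divff ?rpred1.
  by rewrite /= negbK => /eqP->; rewrite mul0r rpred0.
move=> _; have [ycV|cyV] := orP (valuationV (y / c)).
  exists c; split=> //; first by rewrite inE cs orbT.
  by move=> z; rewrite inE => /orP[/eqP->|/hc].
have [y0|nzy] := eqVneq y 0.
  exists c; split=> //; first by rewrite inE cs orbT.
  by move=> z; rewrite inE => /orP[/eqP->|/hc //]; rewrite y0 mul0r rpred0.
exists y; split=> //; first exact: mem_head.
move=> z; rewrite inE => /orP[/eqP->|/hc zc]; first by rewrite divff ?rpred1.
have -> : z / y = z / c * (y / c)^-1 by field; rewrite nzc nzy.
by rewrite rpredM.
Qed.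

Lemma exists_normalisation (f : {poly K}) : f != 0 ->
  exists g, [/\ g != 0, g *: f \is a polyOver V & exists i, (g *: f)`_i = 1].
Proof.
move=> nzf; have hs : has (predC1 0) f.
  apply/hasP; exists (lead_coef f); last by rewrite /= lead_coef_eq0.
  by rewrite lead_coefE mem_nth // prednK // size_poly_gt0.
have [c [cf nzc hc]] := exists_dominating_term hs.
exists c^-1; split; first by rewrite invr_eq0.
  apply/polyOverP => i; rewrite coefZ mulrC.
  have [h|h] := ltnP i (size f); first by rewrite hc // mem_nth.
  by rewrite nth_default // mul0r rpred0.
have [i hi ei] := nthP 0 cf; exists i.
by rewrite coefZ ei mulVf.
Qed.

(* An integral equation for [x], multiplied by a power of [x^-1]. *)
Lemma int_root_in_valuation_ring (q : {poly int}) x :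
  root (map_poly (fun z : int => z%:~R) q) x -> (lead_coef q)%:~R != 0 :> K ->
  (lead_coef q)%:~R^-1 \in V -> x \in V.
Proof.
move=> rq nz lV; have [//|iV] := orP (valuationV x).
have [->|nzx] := eqVneq x 0; first exact: rpred0.
have nzq : q != 0 by apply: contraNneq nz => ->; rewrite lead_coef0.
have [n sq] : exists n, size q = n.+1.
  by exists (size q).-1; rewrite prednK // size_poly_gt0.
move: rq; rewrite /root -[map_poly _ q]/(map_poly intr q).
rewrite (@horner_coef_wide _ n.+1); last by rewrite size_map_poly_id0 ?sq.
rewrite big_ord_recr /= coef_map /= => /eqP e.
have lq : q`_n = lead_coef q by rewrite lead_coefE sq.
rewrite lq in e.
have -> : x = - (lead_coef q)%:~R^-1 * \sum_(i < n) (q`_i)%:~R * x^-1 ^+ (n - i).-1.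
  apply: (mulfI (expf_neq0 n nzx)); apply: (mulfI nz).
  set S := \sum_(i < n) _.
  have -> : (lead_coef q)%:~R * (x ^+ n * (- (lead_coef q)%:~R^-1 * S)) = - (x ^+ n * S).
    by field.
  rewrite mulrA mulr_sumr.
  have -> : (lead_coef q)%:~R * x ^+ n = - \sum_(i < n) (map_poly intr q)`_i * x ^+ i :> K.
    by apply/eqP; rewrite -subr_eq0 opprK addrC e.
  rewrite mulNr; congr (- _); rewrite mulr_suml; apply: eq_bigr => i _.
  rewrite coef_map /= exprVn.
  have -> : x ^+ n = x ^+ i * x * x ^+ (n - i).-1.
    by rewrite -exprSr -exprD; congr (_ ^+ _); have := ltn_ord i; lia.
  by field; rewrite expf_neq0.
rewrite mulNr rpredN rpredM // rpred_sum // => i _.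
by rewrite rpredM ?rpredX // rpred_int.
Qed.

End NormalisingPolynomials.

(** * Number fields *)

(** As [p] lies in every subring, the second condition places it in the maximal ideal. *)
Definition valuation_above (K : fieldType) (p : nat) (V : subringClosed K) : Prop :=
  (forall y, (y \in V) || (y^-1 \in V)) /\ p%:R^-1 \notin V.

Section NumberField.
Variable K : fieldExtType rat.

Lemma ext_rat_intr_eq0 (z : int) : (z%:~R == 0 :> K) = (z == 0).
Proof. by rewrite -(rmorph_int (in_alg K)) fmorph_eq0 intr_eq0. Qed.

(** [exists_valuation_ring] is applied to the image of the integers, in which [p] has no inverse. *)
Lemma exists_valuation_above p : prime p -> exists V : subringClosed K, valuation_above p V.
Proof.
move=> pr_p; pose V0 : {pred K} := [pred y | `[< exists z : int, y = z%:~R >]].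
have sub0 : subring_closed V0.
  split; first by apply/asboolP; exists 1.
  - by move=> _ _ /asboolP[y ->] /asboolP[z ->]; apply/asboolP; exists (y - z); rewrite rmorphB.
  - by move=> _ _ /asboolP[y ->] /asboolP[z ->]; apply/asboolP; exists (y * z); rewrite rmorphM.
have p0 : p%:R \in V0 by apply/asboolP; exists p%:Z.
have nzp : p%:R != 0 :> K by rewrite pmulrn ext_rat_intr_eq0; have := prime_gt0 pr_p; lia.
have ip0 : p%:R^-1 \notin V0.
  apply/negP => /asboolP[z ez].
  have : (p%:Z * z - 1)%:~R = 0 :> K by rewrite rmorphB rmorphM /= -ez divff // subrr.
  move/eqP; rewrite ext_rat_intr_eq0 subr_eq0 => /eqP e.
  have : (p %| 1)%N by apply/dvdnP; exists `|z|%N; have := congr1 absz e; rewrite abszM mulnC.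
  by rewrite dvdn1 => /eqP p1; rewrite p1 in pr_p.
have [V [_ iV vV]] := exists_valuation_ring sub0 p0 ip0.
by exists V.
Qed.

(** The minimal polynomial over the rationals, cleared of denominators and content. Primitivity
    keeps it nonzero modulo every prime, and the degree bound is uniform in [x]. *)
Lemma exists_primitive_int_poly (x : K) : exists q : {poly int},
  [/\ zcontents q = 1, (size q <= (\dim {:K}).+1)%N &
      root (map_poly (fun z : int => z%:~R) q) x].
Proof.
have /polyOver1P [r er] := minPolyOver 1%AS x.
have [q [a nza eq]] := rat_poly_scale r.
have sr : size r = size q.
  rewrite eq size_scale ?invr_eq0 ?intr_eq0 // size_map_inj_poly //.
  exact: intr_inj.
have nzq : q != 0.
  apply: contraTneq isT => q0; have := root_minPoly 1%AS x.
  have : minPoly 1%AS x != 0 by rewrite monic_neq0 // monic_minPoly.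
  by rewrite er eq q0 map_poly0 scaler0 map_poly0 eqxx.
exists (zprimitive q); split.
- by rewrite zcontents_primitive nzq.
- rewrite size_zprimitive -sr -(size_map_poly (in_alg K)) -er size_minPoly ltnS.
  by rewrite adjoin_degreeE dimv1 divn1 dimvS // subvf.
- have := root_minPoly 1%AS x; rewrite er eq /root.
  rewrite map_polyZ hornerZ mulf_eq0 fmorph_eq0 invr_eq0 intr_eq0 (negbTE nza) /=.
  rewrite {1}(zpolyEprim q) -map_poly_comp /=.
  have ef : (in_alg K \o intr) =1 (intr : int -> K).
    by move=> z; exact: (rmorph_int (in_alg K)).
  rewrite (eq_map_poly ef).
  rewrite map_polyZ hornerZ mulf_eq0 ext_rat_intr_eq0 zcontents_eq0 (negbTE nzq) /=.
  by [].
Qed.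

Section Above.
Variables (p : nat) (V : subringClosed K).
Hypothesis pr_p : prime p.
Hypothesis Vp : valuation_above p V.

Let valuationV y : (y \in V) || (y^-1 \in V). Proof. by case: Vp => /(_ y). Qed.

Lemma residue_map_prime (k : fieldType) (phi : K -> k) : residue_map V phi -> p%:R = 0 :> k.
Proof.
move=> hphi; have [_ ip] := Vp.
rewrite pmulrn -(residue_map_int hphi) -pmulrn; apply/eqP.
by rewrite (residue_map_eq0 hphi) ?rpred_nat // ip orbT.
Qed.

(** A Bezout relation between [p] and [b], read in the residue field where [p] is zero, forbids [b]
    from vanishing there. *)
Lemma int_inv_above (b : int) : ~~ (p %| absz b)%N -> b%:~R^-1 \in V.
Proof.
move=> ndvd; have [k [phi hphi]] := exists_residue_field valuationV.
have cop : coprimez p%:Z b by rewrite coprimezE /= prime_coprime.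
have [[u v] e] := coprimezP _ _ cop.
apply: contraT => iV; have /eqP : (u * p%:Z + v * b)%:~R = 1 :> k by rewrite e.
rewrite rmorphD !rmorphM /= -pmulrn (residue_map_prime hphi) mulr0 add0r.
rewrite -(residue_map_int hphi b).
have -> : phi b%:~R = 0 by apply/eqP; rewrite (residue_map_eq0 hphi) ?rpred_int // iV orbT.
by rewrite mulr0 eq_sym oner_eq0.
Qed.

Lemma alg_integer_above (x : K) : alg_integer x -> x \in V.
Proof.
case=> P [mP rP]; apply: (int_root_in_valuation_ring valuationV rP).
  by rewrite (monicP mP) oner_neq0.
by rewrite (monicP mP) invr1 rpred1.
Qed.

(* Every residue is a root of one of the finitely many nonzero polynomials
   of bounded degree with coefficients in the prime field. *)
Lemma residue_field_finite (k : fieldType) (phi : K -> k) : residue_map V phi ->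
  exists s : seq k, forall c, c \in s.
Proof.
move=> hphi; pose n := (\dim {:K}).+1.
pose pol (t : {ffun 'I_n -> 'I_p}) : {poly k} :=
  \sum_(i < n) (t i : nat)%:R *: 'X^i.
pose G := \prod_(t | pol t != 0) pol t.
have nzG : G != 0 by apply/prodf_neq0.
have rootG c : root G c.
  have [y yV <-] := residue_map_surj hphi c.
  have [q [cq sq rq]] := exists_primitive_int_poly y.
  have p0 := prime_gt0 pr_p.
  have hlt (i : 'I_n) : (absz (q`_i %% p)%Z < p)%N.
    have := @ltz_pmod q`_i p; have := @modz_ge0 q`_i p; lia.
  pose t : {ffun 'I_n -> 'I_p} := [ffun i => Ordinal (hlt i)].
  have tE (i : 'I_n) : (t i : nat)%:R = (q`_i)%:~R :> k.
    rewrite ffunE /= pmulrn gez0_abs; last by rewrite modz_ge0 //; lia.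
    rewrite [in RHS](divz_eq q`_i p) [RHS]intrD intrM -[p%:~R]pmulrn.
    by rewrite (residue_map_prime hphi) mulr0 add0r.
  have polE : pol t = \sum_(i < n) (q`_i)%:~R *: 'X^i.
    by apply: eq_bigr => i _; rewrite tE.
  (* Since [q] is primitive, [p] misses some coefficient, which is then a unit of [V] with nonzero
     residue. *)
  have nzt : pol t != 0.
    apply: contraT; rewrite negbK => /eqP t0.
    have: (p%:Z %| zcontents q)%Z; last first.
      by rewrite cq dvdz1 /= => /eqP p1; have := pr_p; rewrite p1.
    rewrite dvdz_contents; apply/polyOverP => i.
    have [lt|ge] := ltnP i n; last by rewrite nth_default ?dvdz0 // (leq_trans sq).
    apply: contraT => nd; have iV := int_inv_above nd.
    have nz : (q`_i)%:~R != 0 :> K.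
      by rewrite ext_rat_intr_eq0; apply: contraNneq nd => ->; rewrite dvdz0.
    have := residue_map_unit hphi (rpred_int V q`_i) iV nz.
    rewrite (residue_map_int hphi) => /negP[].
    have := congr1 (fun f : {poly k} => f`_i) t0; rewrite polE coef0 coef_sum.
    rewrite (bigD1 (Ordinal lt)) //= coefZ coefXn eqxx mulr1 big1 ?addr0 => [->//|j].
    by rewrite -val_eqE /= => ne; rewrite coefZ coefXn eq_sym (negbTE ne) mulr0.
  rewrite /G (bigD1 t) //= rootM; apply/orP; left.
  rewrite /root polE horner_sum; apply/eqP.
  transitivity (phi (\sum_(i < n) (q`_i)%:~R * y ^+ i)); last first.
    move: rq; rewrite /root (@horner_coef_wide _ n); last first.
      by apply: leq_trans (size_poly _ _) sq.
    under eq_bigr => i _ do rewrite coef_map_id0 //.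
    by move=> /eqP->; rewrite (residue_map0 hphi).
  rewrite (residue_map_sum hphi); last by move=> i; rewrite rpredM ?rpredX ?rpred_int.
  apply: eq_bigr => i _; rewrite hornerZ hornerXn (residue_mapM hphi) ?rpredX ?rpred_int //.
  by rewrite (residue_map_int hphi) (residue_mapX hphi).
(* Every residue is a root of [G], so lists without repetition have bounded length, and a longest
   one exhausts [k]. *)
pose P m := `[< exists s : seq k, uniq s /\ size s = m >].
have exP : exists m, P m by exists 0%N; apply/asboolP; exists [::].
have ubP m : P m -> (m <= size G)%N.
  move=> /asboolP[s [us <-]]; apply: ltnW.
  by apply: max_poly_roots => //; apply/allP => c _; apply: rootG.
have [m /asboolP[s [us sm]] maxm] := ex_maxnP exP ubP.
exists s => c; apply: contraT => cs.
have /maxm : P m.+1 by apply/asboolP; exists (c :: s); rewrite /= cs us sm.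
by rewrite ltnn.
Qed.

End Above.

(** It suffices that [p] not divide the leading coefficient of an integer polynomial killing [x]. *)
Lemma eventually_integral (x : K) : exists c, forall p (V : subringClosed K),
  prime p -> (c < p)%N -> valuation_above p V -> x \in V.
Proof.
have [q [cq sq rq]] := exists_primitive_int_poly x.
have nzq : q != 0 by apply: contra_eq_neq cq => ->; rewrite zcontents0.
exists `|lead_coef q|%N => p V pr_p lt Vp; have [valV _] := Vp.
apply: (int_root_in_valuation_ring valV rq).
  by rewrite ext_rat_intr_eq0 lead_coef_eq0.
apply: (int_inv_above pr_p Vp); apply/negP => /dvdn_leq.
by rewrite absz_gt0 lead_coef_eq0 nzq => /(_ isT); rewrite leqNgt lt.
Qed.

Lemma eventually_polyOver (f : {poly K}) : exists c, forall p (V : subringClosed K),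
  prime p -> (c < p)%N -> valuation_above p V -> f \is a polyOver V.
Proof.
have ex (i : 'I_(size f)) := eventually_integral f`_i.
have [c hc] := fin_all_exists ex; exists (\max_i c i)%N => p V pr_p lt Vp.
apply/polyOverP => i; have [h|h] := ltnP i (size f).
  by apply: (hc (Ordinal h) p) => //; apply: leq_ltn_trans lt; apply: leq_bigmax.
by rewrite nth_default // rpred0.
Qed.

End NumberField.

(** * Square roots and their reductions *)

Section Reductions.
Variable F : fieldType.
Implicit Types D A P Q U W : {poly F}.

(** If [D = T ^+ 2], then [T - A] and [T + A] have a nonzero product of degree less than [d], so
    both have degree less than [d]; but they differ by [2 A], of degree [d]. *)
Lemma not_square_of_remainder D A d : (2%:R : F) != 0 -> size A = d.+1 ->
  (psize (D - A ^+ 2) <= d)%N -> D - A ^+ 2 != 0 -> ~ exists R, D = R ^+ 2.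
Proof.
move=> two sA sR nzR [T eT].
have e : (T - A) * (T + A) = D - A ^+ 2 by rewrite eT; ring.
have [nz1 nz2] : T - A != 0 /\ T + A != 0.
  by move: nzR; rewrite -e mulf_eq0 negb_or => /andP[].
have sM := size_polyM_neq0 nz1 nz2; rewrite e in sM.
have g1 : (0 < psize (T - A))%N by rewrite size_poly_gt0.
have g2 : (0 < psize (T + A))%N by rewrite size_poly_gt0.
have s1 : (psize (T - A) <= d)%N by lia.
have s2 : (psize (T + A) <= d)%N by lia.
have : (psize ((T + A) - (T - A)) <= d)%N by apply: size_polyD_bound; rewrite ?size_polyN.
have -> : T + A - (T - A) = 2%:R *: A by rewrite -mul_polyC polyCMn; ring.
by rewrite size_scale // sA ltnn.
Qed.

(* The norms of the approximations have bounded degree, so over a finite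
   field two of them agree in norm and modulo their norm. *)
Lemma pell_of_approximations (ks : seq F) D (S P Q : nat -> {poly F}) d B
    (w : nat -> nat) :
  (forall c, c \in ks) -> ~ (exists R, D = R ^+ 2) ->
  (forall M, (B <= M)%N -> (size (S M) <= M + d + 1)%N) ->
  (forall M, (B <= M)%N -> (psize (S M ^+ 2 - 'X^(M + M) * D) <= M + B)%N) ->
  (forall n, Q n != 0) -> (forall n, (size (Q n) <= w n + 1)%N) ->
  (forall n, (w n < w n.+1)%N) ->
  (forall n, exists B', forall M, (B' <= M)%N ->
    (psize ('X^M * P n - Q n * S M) + w n.+1 <= M + 1)%N) ->
  exists U W, W != 0 /\ U ^+ 2 - D * W ^+ 2 = 1.
Proof.
move=> hks hD hS hSD nzQ sQ hw hE.
pose N n := P n ^+ 2 - D * Q n ^+ 2.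
have sN n : (size (N n) <= d)%N.
  have [B' hB'] := hE n; pose M := (B + B' + w n + w n)%N.
  have := @size_norm _ D (S M) (P n) (Q n) M B d (w n) (w n.+1).
  move=> /(_ (hS M _) (hSD M _) (sQ n) (hB' M _)).
  move=> /(_ ltac:(lia) ltac:(lia) ltac:(lia) ltac:(lia)) h.
  by apply: leq_trans h _; have := hw n; lia.
have nzN n : N n != 0.
  by apply/negP => /eqP /(square_of_norm_eq0 (nzQ n)).
have idx c : (index c ks < size ks)%N by rewrite index_mem.
(* Polynomials of size at most [d] are coded in a finite type by the positions of their coefficients
   in [ks]. *)
pose enc (f : {poly F}) : {ffun 'I_d -> 'I_(size ks)} :=
  [ffun i : 'I_d => Ordinal (idx f`_i)].
have encP (f g : {poly F}) : (size f <= d)%N -> (size g <= d)%N ->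
    enc f = enc g -> f = g.
  move=> sf sg e; apply/polyP => i; have [lt|ge] := ltnP i d; last first.
    by rewrite !nth_default // (leq_trans _ ge).
  have := congr1 (fun h : {ffun 'I_d -> 'I_(size ks)} => nat_of_ord (h (Ordinal lt))) e.
  rewrite !ffunE /= => ei.
  by rewrite -(nth_index 0 (hks f`_i)) ei nth_index.
have smod n (f : {poly F}) : (psize (f %% N n) <= d)%N.
  by apply: leq_trans (sN n); apply: ltnW; rewrite ltn_modp.
have [key hkey] := infinite_pigeonhole
  (fun n => (enc (N n), enc (P n %% N n), enc (Q n %% N n))).
have [n0 _ e0] := hkey 0%N.
have wge n : (n <= w n)%N by elim: n => // n IHn; have := hw n; lia.
(* This [n] is so large that, if the two approximations were proportional, the one at [n0] would
   inherit a remainder small enough to make its norm vanish. *)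
have [n hn en] := hkey (n0 + d + w n0 + 2)%N.
move: en; rewrite -e0 => -[eN eP eQ].
have {}eN : N n = N n0 by apply: encP.
rewrite eN in eP eQ.
have := @pell_of_congruent _ D (P n) (Q n) (P n0) (Q n0) (N n0) (nzN n0).
move=> /(_ eN erefl) [].
- exact: encP.
- exact: encP.
- by [].
move=> [c [ePc eQc]]; exfalso.
have nzc : c != 0 by apply: contraNneq (nzQ n) => c0; rewrite eQc c0 scale0r.
have [B' hB'] := hE n; pose M := (B + B' + w n0 + w n0)%N.
have := hB' M ltac:(lia); rewrite ePc eQc -scalerAr -scalerAl -scalerBr size_scale // => hE0.
have := @size_norm _ D (S M) (P n0) (Q n0) M B d (w n0) (w n.+1).
move=> /(_ (hS M _) (hSD M _) (sQ n0) hE0).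
move=> /(_ ltac:(lia) ltac:(lia) ltac:(lia)).
have : (0 < size (N n0))%N by rewrite size_poly_gt0.
rewrite /N; have := wge n.+1; lia.
Qed.

End Reductions.

(** * Integrality of the coefficients of a square root *)

Section SquareRootCoefficients.
Variables (K : fieldType) (V : subringClosed K).

Lemma coefM_top (P Q : {poly K}) m n : (size P <= m.+1)%N -> (size Q <= n.+1)%N ->
  (P * Q)`_(m + n) = P`_m * Q`_n.
Proof.
move=> sP sQ; rewrite coefM.
have lt : (m < (m + n).+1)%N by lia.
rewrite (bigD1 (Ordinal lt)) //= addKn big1 ?addr0 // => i ne.
have [h|h] := ltnP m i; first by rewrite [P`_i]nth_default ?mul0r // (leq_trans sP).
have {ne} : (i : nat) != m by rewrite -val_eqE in ne.
move=> ne; rewrite [Q`__]nth_default ?mulr0 //.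
by apply: leq_trans sQ _; lia.
Qed.

(* Writing [S = T + R] with [T] the terms of degree greater than [i], the
   coefficient of [X^(n+i)] in [S^2] is that of [T^2] plus twice the
   leading coefficient of [S] times [S`_i]. *)
Lemma sqrt_coef_integral (S : {poly K}) n t : size S = n.+1 ->
  lead_coef S ^+ 2 = 1 -> 2%:R^-1 \in V -> (2%:R : K) != 0 ->
  (forall j, (n + t <= j)%N -> (S ^+ 2)`_j \in V) ->
  forall i, (t <= i)%N -> S`_i \in V.
Proof.
move=> sS lS iV two hS2.
have eS : lead_coef S = S`_n by rewrite lead_coefE sS.
have lV : S`_n \in V.
  move/eqP: lS; rewrite eS sqrf_eq1 => /orP[] /eqP->; rewrite ?rpredN ?rpred1 //.
suff h j : forall i, (n - j <= i)%N -> (t <= i)%N -> S`_i \in V.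
  by move=> i ti; apply: (h n) => //; lia.
elim: j => [|j IHj] i hi ti.
  have [->//|ne] := eqVneq i n.
  by rewrite nth_default ?rpred0 // sS; lia.
have [h|lt] := leqP (n - j) i; first exact: IHj.
have lti : (i < n)%N by lia.
pose T := \poly_(l < n.+1) (if (i < l)%N then S`_l else 0).
have TV : T \is a polyOver V.
  apply/polyOver_poly => l _; case: ifP => [il|_]; last exact: rpred0.
  by apply: IHj; lia.
have sT : (size T <= n.+1)%N by exact: size_poly.
have Tn : T`_n = S`_n by rewrite coef_poly ltnSn lti.
pose R := S - T.
have sR : (size R <= i.+1)%N.
  apply/leq_sizeP => l il; rewrite coefB coef_poly ltnS.
  case: (leqP l n) => ln; first by rewrite il subrr.
  by rewrite nth_default ?subrr // sS.
have Ri : R`_i = S`_i by rewrite coefB coef_poly ltnn; case: ifP; rewrite subr0.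
have e : S ^+ 2 = T ^+ 2 + 2%:R *: (T * R) + R * R.
  by rewrite /R -mul_polyC polyCMn; ring.
have := hS2 (n + i)%N ltac:(lia); rewrite e !coefD coefZ coefM_top // Tn Ri.
rewrite [X in _ + _ + X]nth_default; last first.
  by apply: leq_trans (size_polyM_bound sR sR) _; lia.
have T2V : (T ^+ 2)`_(n + i) \in V by apply/polyOverP; rewrite rpredX.
rewrite addr0 => h.
have -> : S`_i = 2%:R^-1 * S`_n *
    ((T ^+ 2)`_(n + i) + 2%:R * (S`_n * S`_i) - (T ^+ 2)`_(n + i)).
  rewrite addrAC subrr add0r.
  transitivity (S`_n ^+ 2 * S`_i); first by rewrite -eS lS mul1r.
  by field.
by rewrite rpredM ?rpredB // rpredM.
Qed.

End SquareRootCoefficients.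

(* A Pell solution of degree [r] is proportional to the approximation of
   degree [wn] such that [wn <= r < w2], and its remainder is too small for
   the degree [w2] unless a coefficient vanishes. *)
Lemma pell_position (F : fieldType) (D S U W P Q P' Q' : {poly F}) M B d r wl wn w2 :
  (2%:R : F) != 0 -> D \is monic -> size D = (2 * d + 1)%N -> (0 < d)%N ->
  size S = (M + d + 1)%N -> lead_coef S ^+ 2 = 1 ->
  (psize (S ^+ 2 - 'X^(M + M) * D) <= M + B)%N ->
  size W = (r + 1)%N -> U ^+ 2 - D * W ^+ 2 = 1 ->
  Q != 0 -> (size Q <= wn + 1)%N -> Q' != 0 -> (size Q' <= wl + 1)%N ->
  (psize ('X^M * P - Q * S) + w2 <= M + 1)%N ->
  (psize ('X^M * P' - Q' * S) + wn <= M + 1)%N ->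
  (wl < wn)%N -> (wn <= r)%N -> (r < w2)%N -> (w2 < wn + d)%N ->
  (B + r + r <= M)%N -> (r + d <= M)%N ->
  [/\ Q`_wn != 0, ('X^M * P - Q * S)`_(M - w2) = 0
    & ('X^M * P' - Q' * S)`_(M - wn) != 0].
Proof.
move=> two mD sD d0 sS lS sSD sW1 eW1 nzQ sQ nzQ' sQ' sE sE' wln wnr rw gap hM1 hM2.
(* The sign of [W] is adjusted so that [U - W sqrt D] is the small conjugate. *)
have {sW1 eW1} [W2 [sW eW lW]] : exists W2 : {poly F}, [/\ size W2 = (r + 1)%N,
    U ^+ 2 - D * W2 ^+ 2 = 1 & lead_coef U = lead_coef W2 * lead_coef S].
  have nzW : W != 0 by rewrite -size_poly_gt0 sW1 addn1.
  have [_ lU] := pell_size (c := 1) mD sD d0 nzW eW1.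
  have /eqP : lead_coef U ^+ 2 = (lead_coef W * lead_coef S) ^+ 2.
    by rewrite exprMn lS mulr1.
  rewrite eqf_sqr => /orP[] /eqP e; [by exists W | exists (- W)].
  by rewrite size_polyN sqrrN lead_coefN mulNr.
move: W2 sW eW lW => {}W sW eW lW.
have nzW : W != 0 by rewrite -size_poly_gt0 sW addn1.
have sWl : (size W <= r + 1)%N by rewrite sW.
have sU : size U = (r + d + 1)%N.
  by have [-> _] := pell_size (c := 1) mD sD d0 nzW eW; rewrite sW addnAC.
have sR := pell_remainder_size two sS sSD sW sU lW eW hM1.
have dvdW (P1 Q1 : {poly F}) a : Q1 != 0 -> (size Q1 <= a + 1)%N -> (a < r + d)%N ->
    (psize ('X^M * P1 - Q1 * S) + r <= M)%N ->
    [/\ U * Q1 = W * P1, W %| Q1 & (r <= a)%N].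
  move=> nzQ1 sQ1 ha hE.
  have e : U * Q1 = W * P1 by exact: (approx_cross_eq sWl sR sQ1 ha hM2 hE).
  have dvd : W %| Q1 := pell_dvd (oner_neq0 _) eW e.
  split=> //; have := leq_trans (dvdp_leq nzQ1 dvd) sQ1.
  by rewrite sW leq_add2r.
have [eQ /dvdpP [h eh] rn] : [/\ U * Q = W * P, W %| Q & (r <= wn)%N].
  by apply: (dvdW _ _ wn); clear -sE wnr rw d0 nzQ sQ; lia.
have {}rn : wn = r by apply/eqP; rewrite eqn_leq wnr.
move: wnr; subst wn => _.
have nzh : h != 0 by apply: contraNneq nzQ => h0; rewrite eh h0 mul0r.
have sM := size_polyM_neq0 nzh nzW; rewrite -eh sW in sM.
have gh : (0 < size h)%N by rewrite size_poly_gt0.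
have [sQr sh] : size Q = (r + 1)%N /\ (size h <= 1)%N.
  by clear -sM gh sQ; lia.
split.
- have -> : r = (size Q).-1 by rewrite sQr addn1.
  by rewrite -lead_coefE lead_coef_eq0.
(* The approximation is a constant multiple of the Pell solution, so its remainder has degree at
   most [-(r + d)], less than [-w2]. *)
- have ePn : P = h * U by apply: (mulfI nzW); rewrite -eQ eh; ring.
  have -> : 'X^M * P - Q * S = h * ('X^M * U - W * S) by rewrite ePn eh; ring.
  rewrite nth_default //; apply: leq_trans (size_polyM_bound sh sR) _.
  by clear -gap; lia.
(* Otherwise the preceding approximation would be good enough for [W] to divide [Q'] as well,
   against [wl < r]. *)
- apply/negP => /eqP z.
  have sE2 : (psize ('X^M * P' - Q' * S) <= M - r)%N.
    apply/leq_sizeP => j; rewrite leq_eqVlt => /orP[/eqP<-//|lt].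
    rewrite nth_default // (leq_trans _ lt) //.
    by rewrite -(leq_add2r r) (leq_trans sE') //; clear -hM2; lia.
  have [_ _ rl] : [/\ U * Q' = W * P', W %| Q' & (r <= wl)%N].
    apply: (dvdW _ _ wl) => //; first by clear -wln; lia.
    by clear -sE2 hM2; lia.
  by move: rl; rewrite leqNgt wln.
Qed.

Lemma exists_crossing (w : nat -> nat) m r : (forall n, (w n < w n.+1)%N) ->
  (w m <= r)%N -> exists n, [/\ (m <= n)%N, (w n <= r)%N & (r < w n.+1)%N].
Proof.
move=> hw; have [t] := ubnP (r - w m); elim: t m => // t IHt m lt le.
have [h|h] := ltnP r (w m.+1); first by exists m.
have [|//|n [mn h1 h2]] := IHt m.+1; first by have := hw m; lia.
by exists n; split=> //; lia.
Qed.

(** * Convergents of the square root of D *)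

Section SquareRoot.
Variables (K : fieldType) (D : {poly K}) (d : nat) (s : laurent K).
Variable alpha : nat -> laurent K.
Hypothesis mD : D \is monic.
Hypothesis sD : size D = (2 * d + 1)%N.
Hypothesis d_gt0 : (0 < d)%N.
Hypothesis not_square : ~ exists R : {poly K}, D = R ^+ 2.
Hypothesis hs : ls_mul_is s s (ls_of_poly D).
Hypothesis halpha : cf_complete s alpha.

Local Notation S M := (ls_trunc M s).
Local Notation p n := (cf_num alpha n).
Local Notation q n := (cf_den alpha n).

Lemma sqrt_trunc : exists B, forall M, (B <= M)%N ->
  [/\ (psize (S M ^+ 2 - 'X^(M + M) * D) <= M + B)%N, size (S M) = (M + d + 1)%N
    & lead_coef (S M) ^+ 2 = 1].
Proof.
have [B hB] := ls_trunc_mul hs; exists B.+1 => M hM.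
have {hB} := hB M ltac:(lia).
rewrite ls_trunc_of_poly mulrA -exprD -expr2 => h.
have sXD := size_polyXnM (M + M) (monic_neq0 mD).
have lt : (psize (S M ^+ 2 - 'X^(M + M) * D) < psize ('X^(M + M) * D))%N.
  by rewrite sXD sD; lia.
have eS : S M ^+ 2 = 'X^(M + M) * D + (S M ^+ 2 - 'X^(M + M) * D).
  by rewrite addrC subrK.
have sS : psize (S M ^+ 2) = (M + M + 2 * d + 1)%N.
  by rewrite eS size_polyDl // sXD sD; lia.
have nzS : S M != 0.
  by apply: contraTneq isT => S0; move: sS; rewrite S0 expr0n size_poly0; lia.
split; first by lia.
  by have := size_polyM_neq0 nzS nzS; rewrite -expr2 sS; lia.
by rewrite -lead_coef_exp eS lead_coefDl // lead_coef_monicM ?monicXn // (monicP mD).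
Qed.

(** A degree jump of [d] or more would make the norm of the convergent a constant by [size_norm],
    nonzero because [D] is not a square. *)
Lemma cf_den_gap : ~ pellian D -> forall n,
  (size (q n.+2) < size (q n.+1) + d)%N.
Proof.
move=> npell n; rewrite ltnNge; apply/negP => gap; apply: npell.
have [B hB] := sqrt_trunc; have [B' hB'] := size_lead_cf_rem halpha n.+1.
have nzq := cf_den_neq0 halpha n; have gq : (0 < size (q n.+1))%N by rewrite size_poly_gt0.
pose M := (B + B' + size (q n.+1) + size (q n.+1))%N.
have [sSD sS _] := hB M ltac:(lia); have [sE _] := hB' M ltac:(lia).
have sN : (psize (p n.+1 ^+ 2 - D * q n.+1 ^+ 2) <= 1)%N.
  have := @size_norm _ D (S M) (p n.+1) (q n.+1) M B d (size (q n.+1)).-1 (size (q n.+2)).-1.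
  move=> /(_ _ sSD) h; apply: leq_trans (h _ _ _ _) _; rewrite ?sS //; try by lia.
  by rewrite -[_ - _]/(cf_rem s alpha M n.+1); lia.
exists (p n.+1), (q n.+1); split=> //; exists (p n.+1 ^+ 2 - D * q n.+1 ^+ 2)`_0.
rewrite -size1_polyC //; split=> //.
apply/negP => /eqP c0; apply: not_square.
by apply: (square_of_norm_eq0 (P := p n.+1) nzq); rewrite (size1_polyC sN) c0.
Qed.

(** * Reduction of the convergents to the residue field *)

Section Reduction.
Variables (V : subringClosed K) (k : fieldType) (phi : K -> k).
Hypothesis valuationV : forall y, (y \in V) || (y^-1 \in V).
Hypothesis hphi : residue_map V phi.
Hypothesis two : (2%:R : K) != 0.
Hypothesis inv2V : 2%:R^-1 \in V.
Hypothesis DV : D \is a polyOver V.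
Hypothesis remV : (lead_coef (D - pfloor s ^+ 2))^-1 \in V.

Local Notation red := (reduce phi).

Lemma two_residue : (2%:R : k) != 0.
Proof.
rewrite pmulrn -(residue_map_int hphi) -pmulrn.
by apply: (residue_map_unit hphi); rewrite ?rpred_nat.
Qed.

Lemma ls_trunc_integral M : S M \is a polyOver V.
Proof.
have [B hB] := sqrt_trunc; apply/polyOverP => i.
(* Truncating [B] places further moves the coefficient out of reach of the truncation error in the
   square. *)
have -> : (S M)`_i = (S (M + B))`_(i + B).
  by rewrite !coef_ls_trunc; congr (ls_coef _ _); lia.
have [sSD sS lS] := hB (M + B)%N ltac:(lia).
apply: (@sqrt_coef_integral _ _ _ (M + B + d) B); rewrite ?addn1 ?sS //; try by lia.
move=> j hj; have -> : (S (M + B) ^+ 2)`_j = ('X^(M + B + (M + B)) * D)`_j.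
  apply/eqP; rewrite -subr_eq0 -coefB nth_default //.
  by apply: leq_trans sSD _; lia.
by apply/polyOverP; rewrite rpredM // rpredX // polyOverX.
Qed.

Lemma reduced_size_monic : size (red D) = (2 * d + 1)%N /\ red D \is monic.
Proof.
have nz : phi (lead_coef D) != 0.
  by rewrite (monicP mD) (residue_map1 hphi) oner_neq0.
have [-> e] := size_reduce_unit hphi DV nz; split=> //.
by rewrite monicE e (monicP mD) (residue_map1 hphi).
Qed.

Lemma reduced_sqrt_trunc : exists B, forall M, (B <= M)%N ->
  [/\ (psize (red (S M) ^+ 2 - 'X^(M + M) * red D) <= M + B)%N,
      size (red (S M)) = (M + d + 1)%N & lead_coef (red (S M)) ^+ 2 = 1].
Proof.
have [B hB] := sqrt_trunc; exists B => M /hB [sSD sS lS].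
have SV := ls_trunc_integral M.
have lV : lead_coef (S M) \in V by apply/polyOverP.
have e1 : phi (lead_coef (S M)) ^+ 2 = 1.
  by rewrite expr2 -(residue_mapM hphi) // -expr2 lS (residue_map1 hphi).
have nz : phi (lead_coef (S M)) != 0.
  by apply: contra_eq_neq e1 => ->; rewrite expr0n eq_sym oner_neq0.
have [-> ->] := size_reduce_unit hphi SV nz; split=> //.
have XDV : 'X^(M + M) * D \is a polyOver V by rewrite rpredM // rpredX // polyOverX.
have -> : red (S M) ^+ 2 - 'X^(M + M) * red D = red (S M ^+ 2 - 'X^(M + M) * D).
  rewrite (reduceD hphi) ?rpredN ?rpredX // (reduceN hphi) // !expr2 !(reduceM hphi) //.
    by rewrite (reduceXn hphi).
  by rewrite rpredX // polyOverX.
exact: leq_trans (size_reduce _ _) sSD.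
Qed.

(** By [remV] the remainder of [D] after the square of the floor of [s] keeps a nonzero reduction,
    so [not_square_of_remainder] applies over [k]. *)
Lemma reduced_not_square : ~ exists R : {poly k}, red D = R ^+ 2.
Proof.
have [B hB] := sqrt_trunc; pose M := B.+1.
have [sSD sS lS] := hB M ltac:(lia).
have eS : S M = 'X^M * pfloor s + ls_trunc M (ls_frac s) := ls_trunc_floor M s.
have sF := size_ls_trunc_frac M s.
have nzA : pfloor s != 0.
  apply: contraTneq isT => A0; move: eS; rewrite A0 mulr0 add0r => eS.
  by move: sF; rewrite -eS sS; lia.
have sXA := size_polyXnM M nzA.
have lt : (size (ls_trunc M (ls_frac s)) < psize ('X^M * pfloor s))%N.
  have gA : (0 < size (pfloor s))%N by rewrite size_poly_gt0.
  by rewrite sXA; lia.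
have sA : size (pfloor s) = d.+1.
  by have := sS; rewrite eS size_polyDl // sXA; lia.
have lA : lead_coef (pfloor s) ^+ 2 = 1.
  by have := lS; rewrite eS lead_coefDl // lead_coef_monicM ?monicXn.
have AV : pfloor s \is a polyOver V.
  apply/polyOverP => i; have -> : (pfloor s)`_i = (S 0)`_i.
    by rewrite coef_ls_trunc coef_ls_floor subr0.
  by apply/polyOverP; exact: ls_trunc_integral.
have lV : lead_coef (pfloor s) \in V by apply/polyOverP.
have e1 : phi (lead_coef (pfloor s)) ^+ 2 = 1.
  by rewrite expr2 -(residue_mapM hphi) // -expr2 lA (residue_map1 hphi).
have nz : phi (lead_coef (pfloor s)) != 0.
  by apply: contra_eq_neq e1 => ->; rewrite expr0n eq_sym oner_neq0.
have [sA' _] := size_reduce_unit hphi AV nz.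
have sR : (psize (D - pfloor s ^+ 2) <= d)%N.
  have := @size_norm _ D (S M) (pfloor s) 1 M B d 0 1.
  rewrite sS size_poly1 expr1n mulr1 mul1r -(opprB D) size_polyN => h.
  apply: leq_trans (h _ sSD _ _ _) _ => //; try by lia.
  by rewrite eS opprD addNKr size_polyN !addn1 ltnS.
have RV : D - pfloor s ^+ 2 \is a polyOver V by rewrite rpredB // rpredX.
have nzR : D - pfloor s ^+ 2 != 0.
  by apply/negP => /eqP/subr0_eq e; apply: not_square; exists (pfloor s).
have eR : red D - red (pfloor s) ^+ 2 = red (D - pfloor s ^+ 2).
  by rewrite (reduceD hphi) ?rpredN ?rpredX // (reduceN hphi) ?rpredX // !expr2 (reduceM hphi).
apply: (@not_square_of_remainder _ _ (red (pfloor s)) d two_residue); rewrite ?eR ?sA' //.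
  exact: leq_trans (size_reduce _ _) sR.
have lRV : lead_coef (D - pfloor s ^+ 2) \in V by apply/polyOverP.
have nzl : phi (lead_coef (D - pfloor s ^+ 2)) != 0.
  by apply: (residue_map_unit hphi) => //; rewrite lead_coef_eq0.
rewrite -size_poly_gt0; have [-> _] := size_reduce_unit hphi RV nzl.
by rewrite size_poly_gt0.
Qed.

(** The two elements of [V] are the leading coefficients of the scaled denominator and of the scaled
    remainder. Either may reduce to zero, so their residues are recorded at the original degrees. *)
Lemma reduced_convergent n : exists (g : K) (P Q : {poly k}) B,
  [/\ g * lead_coef (q n.+1) \in V, g * ((-1) ^+ n.+1 / lead_coef (q n.+2)) \in V,
      Q != 0 /\ g != 0, (size Q <= size (q n.+1))%N /\
      Q`_(size (q n.+1)).-1 = phi (g * lead_coef (q n.+1)) &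
      forall M, (B <= M)%N ->
        (psize ('X^M * P - Q * red (S M)) + size (q n.+2) <= M + 2)%N /\
        ('X^M * P - Q * red (S M))`_(M + 1 - size (q n.+2))
          = phi (g * ((-1) ^+ n.+1 / lead_coef (q n.+2)))].
Proof.
have nzq := cf_den_neq0 halpha n; have nzq' := cf_den_neq0 halpha n.+1.
have gq' : (1 < size (q n.+2))%N.
  have := size_cf_den_lt halpha n.+1.
  by have : (0 < size (q n.+1))%N; [rewrite size_poly_gt0 | lia].
have [g [nzg gqV [i gq1]]] := exists_normalisation valuationV nzq.
have [B hB] := size_lead_cf_rem halpha n.+1.
have eE M : 'X^M * (g *: p n.+1) - (g *: q n.+1) * S M = g *: cf_rem s alpha M n.+1.
  by rewrite /cf_rem -scalerAr -scalerAl -scalerBr.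
(* The remainder has negative degree, so the numerator is the polynomial part of the denominator
   times [sqrt D] and inherits integrality. *)
have gpV : g *: p n.+1 \is a polyOver V.
  apply/polyOverP => j; have [sE _] := hB B (leqnn _).
  have -> : (g *: p n.+1)`_j = ((g *: q n.+1) * S B)`_(B + j).
    have : ('X^B * (g *: p n.+1) - (g *: q n.+1) * S B)`_(B + j) = 0.
      have le : (size (cf_rem s alpha B n.+1) <= B + j)%N by lia.
      by rewrite eE coefZ nth_default ?mulr0.
    by rewrite coefB coefXnM ltnNge leq_addr /= addKn => /eqP; rewrite subr_eq0 => /eqP.
  by apply/polyOverP; rewrite rpredM // ls_trunc_integral.
have gEV M : g *: cf_rem s alpha M n.+1 \is a polyOver V.
  by rewrite -eE rpredB // rpredM ?rpredX ?polyOverX ?ls_trunc_integral.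
have redE M : 'X^M * red (g *: p n.+1) - red (g *: q n.+1) * red (S M) =
    red (g *: cf_rem s alpha M n.+1).
  rewrite -eE (reduceD hphi) ?rpredN ?rpredM ?rpredX ?polyOverX ?ls_trunc_integral //.
  rewrite (reduceN hphi) ?rpredM ?ls_trunc_integral //.
  by rewrite !(reduceM hphi) ?rpredX ?polyOverX ?ls_trunc_integral // (reduceXn hphi).
have lE M : (B <= M)%N -> lead_coef (cf_rem s alpha M n.+1) =
    (-1) ^+ n.+1 / lead_coef (q n.+2).
  by move=> /hB [_ <-]; rewrite mulfK // lead_coef_eq0.
have idx M : (B <= M)%N -> (M + 1 - size (q n.+2))%N = (size (cf_rem s alpha M n.+1)).-1.
  by move=> /hB [sE _]; lia.
exists g, (red (g *: p n.+1)), (red (g *: q n.+1)), B; split.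
- by rewrite -[g * _]lead_coefZ; apply/polyOverP.
- by rewrite -(lE B) // -[g * _]lead_coefZ; apply/polyOverP.
- split=> //; apply: contraTneq isT => z.
  have := congr1 (fun f : {poly k} => f`_i) z.
  by rewrite (coef_reduce hphi) gq1 coef0 (residue_map1 hphi) => /eqP; rewrite oner_eq0.
- split; first by apply: leq_trans (size_reduce _ _) _; rewrite size_scale.
  by rewrite (coef_reduce hphi) coefZ lead_coefE.
- move=> M hM; rewrite redE; split; last first.
    by rewrite (coef_reduce hphi) idx // coefZ -lead_coefE lE.
  have [sE _] := hB M hM; rewrite -sE leq_add2r.
  by apply: leq_trans (size_reduce _ _) _; rewrite size_scale.
Qed.

Lemma partial_quotient_not_integral (ks : seq k) : (forall c, c \in ks) ->
  ~ pellian D -> forall m, exists2 n, (m <= n)%N & lead_coef (pfloor (alpha n)) \notin V.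
Proof.
move=> hks npell m.
have [g hg] := choice reduced_convergent; have [P hP] := choice hg.
have [Q hQ] := choice hP; have [B hB] := choice hQ => {hg hP hQ}.
have [B0 hB0] := reduced_sqrt_trunc.
have [sD' mD'] := reduced_size_monic.
pose w n := (size (q n.+1)).-1.
have gq n : (0 < size (q n.+1))%N by rewrite size_poly_gt0 (cf_den_neq0 halpha).
have wE n : size (q n.+1) = (w n + 1)%N by rewrite addn1 prednK.
have hw n : (w n < w n.+1)%N.
  by have := size_cf_den_lt halpha n.+1; rewrite !wE ltn_add2r.
have sQ n : (size (Q n) <= w n + 1)%N by have [_ _ _ []] := hB n; rewrite wE.
have sE n M : (B n <= M)%N ->
    (psize ('X^M * P n - Q n * red (S M)) + w n.+1 <= M + 1)%N.
  move=> hM; have [_ _ _ _ /(_ M hM) [sE _]] := hB n.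
  by move: sE; rewrite wE addnA (addnA M 1%N 1%N) leq_add2r.
have nzQ n : Q n != 0 by have [_ _ []] := hB n.
have [U0 [W0 [nzW0 eW0]]] : exists U W : {poly k}, W != 0 /\ U ^+ 2 - red D * W ^+ 2 = 1.
  apply: (@pell_of_approximations _ ks (red D) (fun M => red (S M)) P Q d B0 w) => //.
  - exact: reduced_not_square.
  - by move=> M /hB0 [_ -> _].
  - by move=> M /hB0 [].
  - by move=> n; exists (B n) => M; apply: sE.
(* A Pell solution beyond degree [w m.+1] forces the crossing index past [m]; that index is then a
   successor, so a preceding convergent is available. *)
have [U [W [sW eW]]] :=
  pell_size_unbounded two_residue mD' sD' d_gt0 nzW0 eW0 (w m.+1).
have [r sWr] : exists r, size W = (r + 1)%N.
  by exists (size W).-1; rewrite addn1 prednK // (leq_ltn_trans _ sW).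
have [n [mn wnr rnw]] : exists n, [/\ (m.+1 <= n)%N, (w n <= r)%N & (r < w n.+1)%N].
  by apply: exists_crossing => //; rewrite -ltnS -(addn1 r) -sWr.
case: n mn wnr rnw => // l ml wr rw.
pose M := (B0 + B l + B l.+1 + r + r + d)%N.
have [sSD sS lS] : [/\ (psize (red (S M) ^+ 2 - 'X^(M + M) * red D) <= M + B0)%N,
    size (red (S M)) = (M + d + 1)%N & lead_coef (red (S M)) ^+ 2 = 1].
  by apply: hB0; rewrite /M; clear; lia.
have hMl : (B l <= M)%N by rewrite /M; clear; lia.
have hMn : (B l.+1 <= M)%N by rewrite /M; clear; lia.
have gap : (w l.+2 < w l.+1 + d)%N.
  by have := cf_den_gap npell l.+1; rewrite !wE addnAC ltn_add2r.
have [] := pell_position two_residue mD' sD' d_gt0 sS lS sSD sWr eW (nzQ l.+1)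
  (sQ l.+1) (nzQ l) (sQ l) (sE l.+1 M hMn) (sE l M hMl) (hw l) wr rw gap.
- by rewrite /M; clear; lia.
- by rewrite /M; clear; lia.
have widx n : (M + 1 - size (q n.+1))%N = (M - w n)%N by rewrite wE subnDr.
have [gyV gzV [_ nzg] [_ Qy] /(_ M hMn) [_ Ez]] := hB l.+1.
have [gxV gyV' [_ nzg'] _ /(_ M hMl) [_ Ey]] := hB l.
rewrite /w Qy -widx Ez -widx Ey => phiy phiz phiy'.
apply: contrapT => allV.
have intV a : (m <= a)%N -> lead_coef (pfloor (alpha a)) \in V.
  by move=> ma; apply: contrapT => /negP nV; apply: allV; exists a.
have A1V := intV l.+1 (leqW ml); have A2V := intV l.+2 (leqW (leqW ml)).
have [_ lq1] := size_lead_cf_denSS halpha l.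
have [_ lq2] := size_lead_cf_denSS halpha l.+1.
have nzx : lead_coef (q l.+1) != 0 by rewrite lead_coef_eq0 (cf_den_neq0 halpha).
have nzy : lead_coef (q l.+2) != 0 by rewrite lead_coef_eq0 (cf_den_neq0 halpha).
have nzz : lead_coef (q l.+3) != 0 by rewrite lead_coef_eq0 (cf_den_neq0 halpha).
have [_ iyV] := residue_map_inv hphi gyV phiy.
have [_ iyV'] := residue_map_inv hphi gyV' phiy'.
pose A1 := lead_coef (pfloor (alpha l.+1)); pose A2 := lead_coef (pfloor (alpha l.+2)).
pose x := lead_coef (q l.+1); pose y := lead_coef (q l.+2); pose z := lead_coef (q l.+3).
have nzs : (-1 : K) ^+ l.+1 != 0 by rewrite signr_eq0.
(* If both partial quotients had leading coefficients in [V], so would [v], since the two inverted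
   factors are units. As [z = A2 * A1 * x], the product of [v] with the scaled leading coefficient
   of the remainder is -1, although that coefficient reduces to zero. *)
pose v := A2 * A1 * (g l * x) * (g l * ((-1) ^+ l.+1 / y))^-1 * (g l.+1 * y)^-1.
have vV : v \in V.
  apply: rpredM; last exact: iyV.
  apply: rpredM; last exact: iyV'.
  by apply: rpredM; first exact: rpredM.
have e1 : g l.+1 * ((-1) ^+ l.+2 / z) * v = - 1.
  rewrite -/x -/y -/z -/A1 -/A2 in lq1 lq2 nzx nzy nzz.
  rewrite /v exprS lq2 lq1; rewrite lq2 lq1 in nzz.
  move: nzz; rewrite !mulf_eq0 !negb_or => /and3P[nzA2 nzA1 _].
  by field; rewrite nzA1 nzA2 nzx nzs nzg nzg'.
have : phi (- 1) = 0 by rewrite -e1 (residue_mapM hphi) // phiz mul0r.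
rewrite (residue_mapN hphi) ?rpred1 // (residue_map1 hphi) => /eqP.
by rewrite oppr_eq0 oner_eq0.
Qed.

End Reduction.
End SquareRoot.

Theorem mainTheorem1 (K : fieldExtType rat) (D : {poly K})
  (hmonic : D \is monic)
  (hnsq : ~ exists q : {poly K}, D = q ^+ 2)
  (heven : ~~ odd (size D).-1)
  (hnpell : ~ pellian D)
  (s : laurent K) (hs : ls_mul_is s s (ls_of_poly D))
  (alpha : nat -> laurent K) (halpha : cf_complete s alpha) :
  exists M : nat, forall p : nat, prime p -> (M < p)%N ->
    forall m : nat, exists n : nat, (m <= n)%N /\
      ~ exists (a : K) (b : int),
          alg_integer a /\ ~~ (p %| absz b)%N /\
          lead_coef (ls_floor (alpha n)) = a / b%:~R.
Proof.
have sD : size D = (2 * (size D).-1./2 + 1)%N.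
  have := odd_double_half (size D).-1; rewrite (negbTE heven) add0n -mul2n => ->.
  by rewrite addn1 prednK // size_poly_gt0 monic_neq0.
(* A monic constant is 1, a square. *)
have d_gt0 : (0 < (size D).-1./2)%N.
  rewrite lt0n; apply/negP => /eqP d0; rewrite d0 in sD; apply: hnsq.
  exists 1; rewrite expr1n; have /size1_polyC e : (size D <= 1)%N by rewrite sD.
  by move: (monicP hmonic); rewrite e lead_coefC => ->.
have [c1 hc1] := eventually_polyOver D.
have [c2 hc2] := eventually_integral (lead_coef (D - pfloor s ^+ 2))^-1.
(* Beyond this bound [D] is integral at [p], the remainder used for [reduced_not_square] has an
   integral inverse leading coefficient, and 2 is a unit. *)
exists (c1 + c2 + 2)%N => p pr_p ltp m.
have [V Vp] := exists_valuation_above K pr_p; have [valV _] := Vp.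
have [k [phi hphi]] := exists_residue_field valV.
have [ks hks] := residue_field_finite pr_p Vp hphi.
have two : (2%:R : K) != 0 by rewrite pmulrn ext_rat_intr_eq0.
have inv2V : 2%:R^-1 \in V.
  rewrite pmulrn; apply: (int_inv_above pr_p Vp); apply/negP => /dvdn_leq.
  by move=> /(_ isT); lia.
have DV : D \is a polyOver V by apply: (hc1 p) => //; lia.
have remV : (lead_coef (D - pfloor s ^+ 2))^-1 \in V by apply: (hc2 p) => //; lia.
have [n mn nV] := partial_quotient_not_integral hmonic sD d_gt0 hnsq hs halpha
  valV hphi two inv2V DV remV hks hnpell m.
exists n; split=> // -[a [b [inta [pb e]]]].
(* Algebraic integers and inverses of integers prime to [p] all lie in [V]. *)
case/negP: nV; rewrite /pfloor e; apply: rpredM.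
  exact: alg_integer_above Vp _ inta.
exact: int_inv_above pr_p Vp _ pb.
Qed.
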